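(* Let $\langle\mathsf{Const},\dots,\mathsf{Infer}\rangle$ be a shield specification with inference strategy $\mathsf{Infer}$. If the dL formula $\mathcal P[\![\mathsf{Infer}]\!]$ (the proof obligation induced by the strategy) is valid, then for every inference action $a\in\mathcal A[\![\mathsf{Infer}]\!]$, every element $(p,e,\varepsilon)$ of the list $[\![\mathsf{Infer}]\!](a)$ is a sound symbolic inference assignment.
   Context: **Differential dynamic logic (dL).** A state maps variables to reals; an interpretation maps each function symbol to a real function of its arity (arity $0$: a real). Terms: real literals, variables, $f(\theta_1,\dots,\theta_n)$, $|\theta|$, and $+,\times,\min,\max$ of terms. Hybrid programs: $x:=e$; $x:=*$ (assign an arbitrary real); $?Q$ (test); $x'=f(x)\,\&\,Q$ (follow the ODE system for some duration $\ge0$ while $Q$ holds); $\alpha\cup\beta$ (choice); $\alpha;\beta$; $\alpha^*$ (iteration). Formulas: term comparisons, first-order connectives and real quantifiers, $[\alpha]P$ ($P$ after all runs of $\alpha$), $\langle\alpha\rangle P$ ($P$ after some run). $[\![P]\!]$ is the set of pairs $(I,s)$ (interpretation, state) satisfying $P$; $[\![\theta]\!](I,s)\in\mathbb R$. $P$ is valid if it holds for all $(I,s)$. Interpretations/valuations need only be defined on the symbols/free variables involved; $v\cup v'$ is the union of valuations with disjoint domains; $\mathrm{FV}$ denotes free variables. **Indexed variables.** For each variable $x$ and $i\in\mathbb N$ (or symbolic index $i$) there is a distinct variable $x_i$. For a partial valuation $v$, $v^{(i)}=\{x_i\mapsto v(x)\}$; for a formula or expression $Q$, $Q^{(i)}$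 is $Q$ with each free variable $x$ replaced by $x_i$. $Q[i\backslash j]$ replaces symbolic indices $i=(i_1,\dots,i_m)$ by numbers $j=(j_1,\dots,j_m)$. **Shield specification (components relevant here; the others, i.e. controller, plant and safety formula, play no role in the claim).** - $\mathsf{Const}$: symbols of arity $0$. $\mathsf{Unknown}$: symbols of fixed arities. $\mathsf{Assum}$: a conjunction of formulas over constants and unknowns, without free variables. $\mathsf{StateVar}$: state variables; $\mathsf{State}=\mathsf{StateVar}\to\mathbb R$. - $\mathsf{Param}$: parameter variables; each $p$ has a formula $\mathsf{Bound}_p$ over $p$, constants, unknowns and state variables (no other parameter). $\mathsf{Bound}_p[\theta]$ is $\mathsf{Bound}_p$ with $\theta$ substituted for $p$. All bounds are taken to be upper bounds (a lower-bound parameter $p$ is replaced by $-p$): $\forall x\forall y\,(x\le y\to\mathsf{Bound}_p[x]\to\mathsf{Bound}_p[y])$ is valid. $p$ is local if $\mathsf{Bound}_p$ has a free state variable, global otherwise. For a partial valuation $b$ of $\mathsf{Param}$, $\mathsf{Bound}[b]=\bigwedge_{p\in\mathrm{dom}\,b}\mathsf{Bound}_p[b(p)]$. - $\mathsf{Inv}$: a formula over constants, unknowns, state variables and global parameters. - $\mathsf{NoiseVar}$: mutually independent noise variables, each $\eta$ with a distribution expression $\mathsf{Noise}_\eta$ of the form $\mathcal N(\theta_1,\theta_2)$ (normal), $\mathcal U(\theta_1,\theta_2)$ (uniform) or $\mathcal B(\theta_1)$ (Bernoulli), with terms over constants and state variables. $[\![\mathsf{Noise}]\!](c,s)$ is the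 resulting product distribution on $\mathsf{NoiseVar}\to\mathbb R$. - $\mathsf{ObsVar}$: observation variables, each $\omega$ with a term $\mathsf{Obs}_\omega$ over constants, unknowns, state variables and noise variables. - $\mathsf{Infer}$: an inference strategy (below). **Symbolic bound instantiations.** $e ::= \theta \mid e_1+e_2\mid (e \text{ when } Q)\mid \overline{\mathrm{CDF}}^{-1}_{\eta_1\sim\delta_1\cdots\eta_k\sim\delta_k}(\theta_1,\theta_2)$, with $Q$ quantifier- and modality-free and $\delta_i$ distribution expressions. $[\![e]\!](I,v)\in\mathbb R\cup\{\bot\}$ is evaluated in the natural way; it is $\bot$ if an undefined symbol or variable is accessed, or if $Q$ is false in ''$e$ when $Q$''. The operator $\overline{\mathrm{CDF}}^{-1}$ is any fixed implementation returning either $\bot$ or a real $b$ such that $\mathbb P\big([\![\theta_1]\!](I,v\cup\{\eta_i\}_i)>b\big)\le[\![\theta_2]\!](I,v)$ for independent $\eta_i\sim[\![\delta_i]\!](I,v)$. **Inference strategies.** $\mathsf{Infer}$ is a sequence $p_1:=e_1;\dots;p_k:=e_k$ of assignments to parameters, where each $e$ has one of the forms (D) $\theta$ when $G$; (B) best $i_1,\dots,i_m:\theta$ when $G$; (A) aggregate $i_1,\dots,i_m:\theta_1$ and $\theta_2$ when $G$, where $\theta_1$ may contain observation variables but no noise variables and $\theta_2$ may contain noise variables but no observation variables. (''when $G$'' may be omitted if $G=\mathrm{true}$.) Action spaces: (D) a one-point set; (B) finite lists of elements of $\mathbb N^m$; (A) pairs $(\varepsilon,D)$ with $\varepsilon\in[0,1]$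 and $D$ a finite list of pairs $(\lambda,j)$, $\lambda>0$, $j\in\mathbb N^m$, $\sum\lambda=1$. The action space $\mathcal A[\![\mathsf{Infer}]\!]$ is the product of those of its assignments. $[\![\mathsf{Infer}]\!](a)$ is the concatenation of the following lists of triples (symbolic inference assignments: parameter, symbolic bound instantiation, failure probability), one list per assignment $p:=e$: (D) $[(p,\ \theta\text{ when }G,\ 0)]$; (B) on list $J$: $[(p,\ \theta[i\backslash j]\text{ when }G[i\backslash j],\ 0): j\in J]$; (A) on $(\varepsilon,D)$: the single triple $$\Big(p,\ \Big(\sum_{(\lambda,j)\in D}\lambda\,\theta_1[i\backslash j]+\overline{\mathrm{CDF}}^{-1}\Big(\sum_{(\lambda,j)\in D}\lambda\,\theta_2[i\backslash j],\ \varepsilon\Big)\Big)\text{ when }\bigwedge_{(\lambda,j)\in D}G[i\backslash j],\ \varepsilon\Big),$$ each indexed noise variable $\eta_l$ in the $\overline{\mathrm{CDF}}^{-1}$ expression having distribution $\mathsf{Noise}_\eta^{(l)}$. **Obligation.** $\mathcal P[\![\mathsf{Infer}]\!]$ is the conjunction over assignments $p:=e$ of $\mathsf{Assum}\wedge\bigwedge_{x\in\mathrm{FV}(e)}\mathcal D(x)\to(G\to\mathsf{Bound}_p[\theta])$ in cases (D),(B), and $\mathsf{Assum}\wedge\bigwedge_{x\in\mathrm{FV}(e)}\mathcal D(x)\to(G\to\mathsf{Bound}_p[\theta_1+\theta_2])$ in case (A). Here $\mathcal D(p)=\mathsf{Bound}_p$ for a parameter $p$, $\mathcal D(\omega)=(\omega=\mathsf{Obs}_\omega)$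 for an observation variable, $\mathcal D(x)=\mathsf{Inv}$ for a state variable, $\mathcal D(x_k)=\mathcal D(x)^{(k)}$ for indexed variables (no condition for noise variables). **Soundness of a symbolic inference assignment.** $(p,e,\varepsilon)$ is sound iff for all $c:\mathsf{Const}\to\mathbb R$, all interpretations $u$ of $\mathsf{Unknown}$, all $n\in\mathbb N$, all states $s_1,\dots,s_n\in\mathsf{State}$, all sets $z_1,\dots,z_n\subseteq\mathsf{ObsVar}$ (available observations) and all partial valuations $b_1,\dots,b_n$ of $\mathsf{Param}$ such that for every $i\le n$, $b_i$ is defined on the global parameters occurring in $\mathsf{Inv}$ and $(c\cup u,\,s_i\cup b_i)\in[\![\mathsf{Assum}\wedge\mathsf{Inv}\wedge\mathsf{Bound}[b_i]]\!]$, we have $$\mathbb P\big\{(c\cup u,s_n)\notin[\![\mathsf{Bound}[\,b_n[p\leftarrow r]\,]]\!]\big\}\le\varepsilon,$$ where $\eta_1,\dots,\eta_n$ are independent with $\eta_i\sim[\![\mathsf{Noise}]\!](c,s_i)$; $o_i=\{\omega\mapsto[\![\mathsf{Obs}_\omega]\!](c\cup u,s_i\cup\eta_i):\omega\in z_i\}$; $v=(s_n\cup b_n)\cup\bigcup_{1\le i\le n}\big(s_i^{(i)}\cup b_i^{(i)}\cup o_i^{(i)}\big)$; $r=[\![e]\!](c,v)$; and $b_n[p\leftarrow r]$ is $b_n$ updated to map $p$ to $r$ (left unchanged if $r=\bot$). *)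

(* Defs.v *)
From HB Require Import structures.
From Stdlib Require List Relations.
From mathcomp Require Import all_boot all_order all_algebra.
From mathcomp Require Import all_classical all_reals all_analysis.

Set Implicit Arguments.
Unset Strict Implicit.
Unset Printing Implicit Defensive.

Import Order.TTheory GRing.Theory Num.Theory.
Import numFieldNormedType.Exports.

Local Open Scope classical_set_scope.
Local Open Scope ring_scope.

Section Syntax.
Variables (R : realType) (F : Type) (ar : F -> nat).

Inductive term (V : Type) : Type :=
| TLit of R
| TVar of V
| TApp (f : F) of ('I_(ar f) -> term V)
| TAbs of term V
| TAdd of term V & term V
| TMul of term V & term V
| TMin of term V & term V
| TMax of term V & term V.

Inductive cmp := CLt | CLe | CEq | CNe | CGe | CGt.

Inductive formula (V : Type) : Type :=
| FTrue
| FCmp of cmp & term V & term V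
| FNot of formula V
| FAnd of formula V & formula V
| FOr of formula V & formula V
| FImp of formula V & formula V
| FIff of formula V & formula V
| FAll of V & formula V
| FEx of V & formula V
| FBox of program V & formula V
| FDia of program V & formula V
with program (V : Type) : Type :=
| PAssign of V & term V
| PRandom of V
| PTest of formula V
| PODE of seq (V * term V) & formula V
| PChoice of program V & program V
| PSeq of program V & program V
| PStar of program V.

Definition bigand (V : Type) (s : seq (formula V)) : formula V :=
  foldr (@FAnd V) (FTrue V) s.

Fixpoint tvars (V : Type) (t : term V) : seq V :=
  match t with
  | TLit _ => [::]
  | TVar x => [:: x]
  | TApp f a => flatten [seq tvars (a i) | i <- enum 'I_(ar f)]
  | TAbs t => tvars t
  | TAdd t u | TMul t u | TMin t u | TMax t u => tvars t ++ tvars u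
  end.

(** Variables bound on every run of a program. *)
Fixpoint MBV (V : eqType) (a : program V) : seq V :=
  match a with
  | PAssign x _ | PRandom x => [:: x]
  | PTest _ | PStar _ => [::]
  | PODE sys _ => unzip1 sys
  | PChoice a b => [seq x <- MBV a | x \in MBV b]
  | PSeq a b => MBV a ++ MBV b
  end.

(** Static free variables, as usual for dL. *)
Fixpoint FV (V : eqType) (P : formula V) : seq V :=
  match P with
  | FTrue => [::]
  | FCmp _ t u => tvars t ++ tvars u
  | FNot P => FV P
  | FAnd P Q | FOr P Q | FImp P Q | FIff P Q => FV P ++ FV Q
  | FAll x P | FEx x P => [seq y <- FV P | y != x]
  | FBox a P | FDia a P => FVp a ++ [seq y <- FV P | y \notin MBV a]
  end
with FVp (V : eqType) (a : program V) : seq V :=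
  match a with
  | PAssign _ t => tvars t
  | PRandom _ => [::]
  | PTest Q => FV Q
  | PODE sys Q => unzip1 sys ++ flatten [seq tvars xt.2 | xt <- sys] ++ FV Q
  | PChoice a b => FVp a ++ FVp b
  | PSeq a b => FVp a ++ [seq y <- FVp b | y \notin MBV a]
  | PStar a => FVp a
  end.

Fixpoint trename (V W : Type) (h : V -> W) (t : term V) : term W :=
  match t with
  | TLit r => TLit W r
  | TVar x => TVar (h x)
  | TApp f a => TApp (fun i => trename h (a i))
  | TAbs t => TAbs (trename h t)
  | TAdd t u => TAdd (trename h t) (trename h u)
  | TMul t u => TMul (trename h t) (trename h u)
  | TMin t u => TMin (trename h t) (trename h u)
  | TMax t u => TMax (trename h t) (trename h u)
  end.

(** Renaming of all occurrences of variables, including binding ones. *)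
Fixpoint rename (V W : Type) (h : V -> W) (P : formula V) : formula W :=
  match P with
  | FTrue => FTrue W
  | FCmp c t u => FCmp c (trename h t) (trename h u)
  | FNot P => FNot (rename h P)
  | FAnd P Q => FAnd (rename h P) (rename h Q)
  | FOr P Q => FOr (rename h P) (rename h Q)
  | FImp P Q => FImp (rename h P) (rename h Q)
  | FIff P Q => FIff (rename h P) (rename h Q)
  | FAll x P => FAll (h x) (rename h P)
  | FEx x P => FEx (h x) (rename h P)
  | FBox a P => FBox (prename h a) (rename h P)
  | FDia a P => FDia (prename h a) (rename h P)
  end
with prename (V W : Type) (h : V -> W) (a : program V) : program W :=
  match a with
  | PAssign x t => PAssign (h x) (trename h t)
  | PRandom x => PRandom (h x)
  | PTest Q => PTest (rename h Q)
  | PODE sys Q =>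
      PODE [seq (h xt.1, trename h xt.2) | xt <- sys] (rename h Q)
  | PChoice a b => PChoice (prename h a) (prename h b)
  | PSeq a b => PSeq (prename h a) (prename h b)
  | PStar a => PStar (prename h a)
  end.

Fixpoint tsubst (V : eqType) (p : V) (e : term V) (t : term V) : term V :=
  match t with
  | TLit r => TLit V r
  | TVar x => if x == p then e else TVar x
  | TApp f a => TApp (fun i => tsubst p e (a i))
  | TAbs t => TAbs (tsubst p e t)
  | TAdd t u => TAdd (tsubst p e t) (tsubst p e u)
  | TMul t u => TMul (tsubst p e t) (tsubst p e u)
  | TMin t u => TMin (tsubst p e t) (tsubst p e u)
  | TMax t u => TMax (tsubst p e t) (tsubst p e u)
  end.

(** Capture-avoiding substitution of [e] for the free occurrences of [p].
   Where a quantifier would capture a variable of [e], and under modalities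
   (whose programs may write to [p] or to variables of [e]), the substitution
   is left as the assignment modality [p := e], which evaluates [e] before
   anything is bound. *)
Fixpoint subst (V : eqType) (p : V) (e : term V) (P : formula V) : formula V :=
  match P with
  | FTrue => FTrue V
  | FCmp c t u => FCmp c (tsubst p e t) (tsubst p e u)
  | FNot P => FNot (subst p e P)
  | FAnd P Q => FAnd (subst p e P) (subst p e Q)
  | FOr P Q => FOr (subst p e P) (subst p e Q)
  | FImp P Q => FImp (subst p e P) (subst p e Q)
  | FIff P Q => FIff (subst p e P) (subst p e Q)
  | FAll x P' =>
      if x == p then P
      else if x \in tvars e then FBox (PAssign p e) P
      else FAll x (subst p e P')
  | FEx x P' =>
      if x == p then P
      else if x \in tvars e then FBox (PAssign p e) P
      else FEx x (subst p e P')
  | FBox _ _ | FDia _ _ => FBox (PAssign p e) P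
  end.

Fixpoint term_over (V : Type) (pf : pred F) (pv : pred V) (t : term V) : bool :=
  match t with
  | TLit _ => true
  | TVar x => pv x
  | TApp f a => pf f && [forall i, term_over pf pv (a i)]
  | TAbs t => term_over pf pv t
  | TAdd t u | TMul t u | TMin t u | TMax t u =>
      term_over pf pv t && term_over pf pv u
  end.

(** False on quantifiers and modalities. *)
Fixpoint qf_over (V : Type) (pf : pred F) (pv : pred V) (P : formula V) : bool :=
  match P with
  | FTrue => true
  | FCmp _ t u => term_over pf pv t && term_over pf pv u
  | FNot P => qf_over pf pv P
  | FAnd P Q | FOr P Q | FImp P Q | FIff P Q =>
      qf_over pf pv P && qf_over pf pv Q
  | FAll _ _ | FEx _ _ | FBox _ _ | FDia _ _ => false
  end.

Definition qf (V : Type) (P : formula V) : bool := qf_over predT predT P.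

(** Distribution expressions; the second argument of [Normal] is the
   variance. *)
Inductive dist (V : Type) : Type :=
| Normal of term V & term V
| Uniform of term V & term V
| Bernoulli of term V.

Definition drename (V W : Type) (h : V -> W) (d : dist V) : dist W :=
  match d with
  | Normal t u => Normal (trename h t) (trename h u)
  | Uniform t u => Uniform (trename h t) (trename h u)
  | Bernoulli t => Bernoulli (trename h t)
  end.

Definition dist_over (V : Type) (pf : pred F) (pv : pred V) (d : dist V) : bool :=
  match d with
  | Normal t u | Uniform t u => term_over pf pv t && term_over pf pv u
  | Bernoulli t => term_over pf pv t
  end.

Definition interp := forall f : F, ('I_(ar f) -> R) -> R.

Fixpoint eval (V : Type) (I : interp) (s : V -> R) (t : term V) : R :=
  match t with
  | TLit r => r
  | TVar x => s x
  | TApp f a => I f (fun i => eval I s (a i))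
  | TAbs t => `|eval I s t|
  | TAdd t u => eval I s t + eval I s u
  | TMul t u => eval I s t * eval I s u
  | TMin t u => Num.min (eval I s t) (eval I s u)
  | TMax t u => Num.max (eval I s t) (eval I s u)
  end.

Definition cmp_sem (c : cmp) (x y : R) : Prop :=
  match c with
  | CLt => x < y
  | CLe => x <= y
  | CEq => x = y
  | CNe => x <> y
  | CGe => x >= y
  | CGt => x > y
  end.

Definition upd (V : eqType) (s : V -> R) (x : V) (r : R) : V -> R :=
  fun y => if y == x then r else s y.

Fixpoint sat (V : eqType) (I : interp) (P : formula V) (s : V -> R) : Prop :=
  match P with
  | FTrue => True
  | FCmp c t u => cmp_sem c (eval I s t) (eval I s u)
  | FNot P => ~ sat I P s
  | FAnd P Q => sat I P s /\ sat I Q s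
  | FOr P Q => sat I P s \/ sat I Q s
  | FImp P Q => sat I P s -> sat I Q s
  | FIff P Q => sat I P s <-> sat I Q s
  | FAll x P => forall r : R, sat I P (upd s x r)
  | FEx x P => exists r : R, sat I P (upd s x r)
  | FBox a P => forall s', run I a s s' -> sat I P s'
  | FDia a P => exists s', run I a s s' /\ sat I P s'
  end
with run (V : eqType) (I : interp) (a : program V) (s s' : V -> R) : Prop :=
  match a with
  | PAssign x t => s' = upd s x (eval I s t)
  | PRandom x => exists r : R, s' = upd s x r
  | PTest Q => s' = s /\ sat I Q s
  | PODE sys Q =>
      exists (T : R) (phi : R -> V -> R),
        [/\ 0 <= T, phi 0 = s, phi T = s' &
          forall t : R, 0 <= t <= T ->
            [/\ sat I Q (phi t),
                forall x, x \notin unzip1 sys -> phi t x = s x &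
                (* derivative relative to [0, T], one-sided at 0 and T *)
                forall x e, List.In (x, e) sys ->
                  (fun y : R => (phi y x - phi t x) / (y - t))
                    @ within (`[0, T] : set R) (t^') --> eval I (phi t) e]]
  | PChoice a b => run I a s s' \/ run I b s s'
  | PSeq a b => exists s1, run I a s s1 /\ run I b s1 s'
  | PStar a => Relation_Operators.clos_refl_trans_1n _ (run I a) s s'
  end.

Definition valid (V : eqType) (P : formula V) : Prop :=
  forall (I : interp) (s : V -> R), sat I P s.

Definition pinterp := forall f : F, option (('I_(ar f) -> R) -> R).
Definition pval (V : Type) := V -> option R.

Definition total_interp (I : pinterp) : interp :=
  fun f => if I f is Some g then g else fun=> 0.
Definition total_val (V : Type) (v : pval V) : V -> R := fun x => odflt 0 (v x).

Definition tdefined (V : Type) (I : pinterp) (v : pval V) : term V -> bool :=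
  term_over (fun f => isSome (I f)) (fun x => isSome (v x)).

Definition peval (V : Type) (I : pinterp) (v : pval V) (t : term V) : option R :=
  if tdefined I v t then Some (eval (total_interp I) (total_val v) t) else None.

(** [Q] is defined and true; only meant for quantifier- and modality-free [Q]. *)
Definition pholds (V : eqType) (I : pinterp) (v : pval V) (Q : formula V) : bool :=
  qf_over (fun f => isSome (I f)) (fun x => isSome (v x)) Q &&
  `[< sat (total_interp I) Q (total_val v) >].

Definition vunion (V : Type) (v w : pval V) : pval V :=
  fun x => if v x is Some r then Some r else w x.

Definition pupd (V : eqType) (v : pval V) (x : V) (r : option R) : pval V :=
  fun y => if y == x then (if r is Some _ then r else v y) else v y.

End Syntax.

Arguments TLit {R F ar V}.
Arguments TVar {R F ar V}.
Arguments FTrue {R F ar V}.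

Section Probability.
Variable R : realType.

Local Notation realprob := (probability (measurableTypeR R) R).

Definition b2r (b : bool) : measurableTypeR R := (b%:R : R).

Lemma measurable_b2r : measurable_fun [set: bool] b2r.
Proof. by []. Qed.

HB.instance Definition _ := isMeasurableFun.Build _ _ _ _ b2r measurable_b2r.

(** Laws; [None] for parameters out of range.  [normal_prob] expects the
   standard deviation, and the library distributions do not cover the
   degenerate (Dirac) cases. *)
Definition normal_law (m v : R) : option realprob :=
  if 0 < v then Some (normal_prob m (Num.sqrt v) : realprob)
  else if v == 0 then Some (\d_(m : measurableTypeR R) : realprob) else None.

Definition uniform_law (a b : R) : option realprob :=
  if @idP (a < b) is ReflectT ab then Some (uniform_prob ab : realprob)
  else if a == b then Some (\d_(a : measurableTypeR R) : realprob) else None.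

Definition bernoulli_law (p : R) : option realprob :=
  if 0 <= p <= 1 then Some (distribution (bernoulli_prob p) b2r : realprob) else None.

Definition dist_law (F : Type) (ar : F -> nat) (V : Type) (I : pinterp R ar)
    (v : pval R V) (d : dist R ar V) : option realprob :=
  match d with
  | Normal t u =>
      if (peval I v t, peval I v u) is (Some m, Some w) then normal_law m w else None
  | Uniform t u =>
      if (peval I v t, peval I v u) is (Some a, Some b) then uniform_law a b else None
  | Bernoulli t => if peval I v t is Some p then bernoulli_law p else None
  end.

Definition mutually_independent (J : eqType) (D : pred J) d
    (T : measurableType d) (P : probability T R)
    (X : J -> {RV P >-> measurableTypeR R}) : Prop :=
  forall (s : seq J) (A : J -> set R), uniq s -> all D s ->
    (forall j, measurable (A j : set (measurableTypeR R))) ->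
    (P (\bigcap_(j in [set` s]) X j @^-1` A j)
     = \prod_(j <- s) P (X j @^-1` A j))%E.

(** P (E eta) <= r for independent eta_j ~ law j, j ranging over [D].  No
   condition is put on the distribution of eta_j when [law j] is [None].
   Unknown function symbols may be interpreted by non-measurable functions, so
   the event need not be measurable: probabilities are outer probabilities,
   which are the ordinary ones on measurable events ([measurable_mu_extE]). *)
Definition prob_le (J : eqType) (D : pred J)
    (law : J -> option realprob)
    (E : (J -> R) -> Prop) (r : R) : Prop :=
  forall (d : measure_display) (T : measurableType d) (P : probability T R)
         (X : J -> {RV P >-> measurableTypeR R}),
    mutually_independent D X ->
    (forall j mu, D j -> law j = Some mu ->
       forall A, measurable A -> distribution P (X j) A = mu A) ->
    (mu_ext P [set w | E (fun j => X j w)] <= r%:E)%E.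

End Probability.

Section SymbolicBounds.
Variables (R : realType) (F : Type) (ar : F -> nat) (V : eqType).

(** [SCdf ds t u] is the inverse complementary CDF operator applied to [t] and
   [u], where [ds] lists the noise variables with their distributions. *)
Inductive sbi : Type :=
| STerm of term R ar V
| SAdd of sbi & sbi
| SWhen of sbi & formula R ar V
| SCdf of seq (V * dist R ar V) & term R ar V & term R ar V.

Definition cdf_law (I : pinterp R ar) (v : pval R V) (ds : seq (V * dist R ar V))
    (x : V) : option (probability (measurableTypeR R) R) :=
  if [seq yd.2 | yd <- ds & yd.1 == x] is d :: _ then dist_law I v d else None.

Definition cdf_val (v : pval R V) (ds : seq (V * dist R ar V)) (eta : V -> R) :
    pval R V :=
  fun x => if x \in unzip1 ds then Some (eta x) else v x.

Definition cdf_defined (I : pinterp R ar) (v : pval R V)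
    (ds : seq (V * dist R ar V)) (t u : term R ar V) : bool :=
  [&& all (fun x => isSome (cdf_law I v ds x)) (unzip1 ds),
      tdefined I (cdf_val v ds (fun=> 0)) t & tdefined I v u].

Definition cdf_impl := pinterp R ar -> pval R V -> seq (V * dist R ar V) ->
  term R ar V -> term R ar V -> option R.

Definition cdf_impl_correct (impl : cdf_impl) : Prop :=
  forall I v ds t u b, cdf_defined I v ds t u -> impl I v ds t u = Some b ->
    prob_le [in unzip1 ds] (cdf_law I v ds)
      (fun eta => eval (total_interp I) (total_val (cdf_val v ds eta)) t > b)
      (eval (total_interp I) (total_val v) u).

Fixpoint eval_sbi (impl : cdf_impl) (I : pinterp R ar) (v : pval R V) (e : sbi) :
    option R :=
  match e with
  | STerm t => peval I v t
  | SAdd e1 e2 =>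
      if (eval_sbi impl I v e1, eval_sbi impl I v e2) is (Some x, Some y)
      then Some (x + y) else None
  | SWhen e Q => if pholds I v Q then eval_sbi impl I v e else None
  | SCdf ds t u => if cdf_defined I v ds t u then impl I v ds t u else None
  end.

End SymbolicBounds.

Arguments SCdf {R F ar V}.

Record signature := Signature {
  Const : Type;
  Unknown : Type;
  arity : Unknown -> nat;
  StateVar : finType;
  Param : finType;
  NoiseVar : finType;
  ObsVar : finType }.

(** [Aux] provides the variables that are only used bound. *)
Inductive base_var (S : signature) : Type :=
| St of StateVar S
| Pa of Param S
| No of NoiseVar S
| Ob of ObsVar S
| Aux of nat.

(** Numeric and symbolic indices; the latter are named by numbers. *)
Inductive index := Num of nat | Sym of nat.

Inductive ivar (S : signature) : Type :=
| Plain of base_var S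
| Idx of base_var S & index.

Arguments St {S}.
Arguments Pa {S}.
Arguments No {S}.
Arguments Ob {S}.
Arguments Aux {S}.
Arguments Plain {S}.
Arguments Idx {S}.

Section VarEq.
Variable S : signature.

Definition base_code (x : base_var S) :
    StateVar S + Param S + NoiseVar S + ObsVar S + nat :=
  match x with
  | St y => inl (inl (inl (inl y)))
  | Pa y => inl (inl (inl (inr y)))
  | No y => inl (inl (inr y))
  | Ob y => inl (inr y)
  | Aux k => inr k
  end.
Definition base_decode (c : StateVar S + Param S + NoiseVar S + ObsVar S + nat) :
    base_var S :=
  match c with
  | inl (inl (inl (inl y))) => St y
  | inl (inl (inl (inr y))) => Pa y
  | inl (inl (inr y)) => No y
  | inl (inr y) => Ob y
  | inr k => Aux k
  end.
Lemma base_codeK : cancel base_code base_decode.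
Proof. by case. Qed.
HB.instance Definition _ := Equality.copy (base_var S) (can_type base_codeK).

Definition index_code (i : index) : nat + nat :=
  match i with Num k => inl k | Sym k => inr k end.
Definition index_decode (c : nat + nat) : index :=
  match c with inl k => Num k | inr k => Sym k end.
Lemma index_codeK : cancel index_code index_decode.
Proof. by case. Qed.
HB.instance Definition _ := Equality.copy index (can_type index_codeK).

Definition ivar_code (x : ivar S) : base_var S + base_var S * index :=
  match x with Plain y => inl y | Idx y i => inr (y, i) end.
Definition ivar_decode (c : base_var S + base_var S * index) : ivar S :=
  match c with inl y => Plain y | inr (y, i) => Idx y i end.
Lemma ivar_codeK : cancel ivar_code ivar_decode.
Proof. by case. Qed.
HB.instance Definition _ := Equality.copy (ivar S) (can_type ivar_codeK).

Definition sym_arity (f : Const S + Unknown S) : nat :=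
  match f with inl _ => 0 | inr g => arity g end.

Definition is_const (f : Const S + Unknown S) : bool :=
  if f is inl _ then true else false.

Definition is_state (x : base_var S) := if x is St _ then true else false.
Definition is_noise (x : base_var S) := if x is No _ then true else false.
Definition is_obs (x : base_var S) := if x is Ob _ then true else false.

Definition ivar_base (x : ivar S) : base_var S :=
  match x with Plain y | Idx y _ => y end.

End VarEq.

Section Specification.
Variables (R : realType) (S : signature).

Local Notation bterm := (term R (@sym_arity S) (base_var S)).
Local Notation bformula := (formula R (@sym_arity S) (base_var S)).
Local Notation iterm := (term R (@sym_arity S) (ivar S)).
Local Notation iformula := (formula R (@sym_arity S) (ivar S)).
Local Notation isbi := (sbi R (@sym_arity S) (ivar S)).
Local Notation bdist := (dist R (@sym_arity S) (base_var S)).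
Local Notation idist := (dist R (@sym_arity S) (ivar S)).

(** Right-hand sides of inference assignments; in [Best] and [Aggregate] the
   sequence lists the names of the symbolic indices i_1, ..., i_m. *)
Inductive iexpr : Type :=
| Direct of iterm & iformula
| Best of seq nat & iterm & iformula
| Aggregate of seq nat & iterm & iterm & iformula.

Definition iexpr_wf (e : iexpr) : bool :=
  match e with
  | Direct _ G => qf G
  | Best ix _ G => uniq ix && qf G
  | Aggregate ix t1 t2 G =>
      [&& uniq ix, qf G,
          all (fun x => ~~ is_noise (ivar_base x)) (tvars t1) &
          all (fun x => ~~ is_obs (ivar_base x)) (tvars t2)]
  end.

Definition global_param (Bound : Param S -> bformula) (p : Param S) : bool :=
  ~~ has (@is_state S) (FV (Bound p)).

(** The controller, plant and safety components are not represented. *)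
Record shield_spec := ShieldSpec {
  Assum : seq bformula;
  Bound : Param S -> bformula;
  Inv : bformula;
  Noise : NoiseVar S -> bdist;
  Obs : ObsVar S -> bterm;
  Infer : seq (Param S * iexpr);
  Assum_closed : forall P, List.In P Assum -> FV P = [::];
  Bound_vars : forall p x, x \in FV (Bound p) -> x = Pa p \/ is_state x;
  Bound_upper : forall p,
    valid (FAll (Aux 0) (FAll (Aux 1)
      (FImp (FCmp CLe (TVar (Aux 0)) (TVar (Aux 1)))
        (FImp (subst (Pa p) (TVar (Aux 0)) (Bound p))
              (subst (Pa p) (TVar (Aux 1)) (Bound p))))));
  Inv_vars : forall x, x \in FV Inv ->
    is_state x \/ exists2 p, x = Pa p & global_param Bound p;
  Noise_over : forall y, dist_over (@is_const S) (@is_state S) (Noise y);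
  Obs_over : forall w,
    term_over predT (fun x => is_state x || is_noise x) (Obs w);
  Infer_wf : all (fun pe => iexpr_wf pe.2) Infer }.

Definition index_formula (i : index) (Q : bformula) : iformula :=
  rename (fun x => if x \in FV Q then Idx x i else Plain x) Q.

Definition inst_var (ix : seq nat) (j : seq nat) (x : ivar S) : ivar S :=
  match x with
  | Idx y (Sym k) => if k \in ix then Idx y (Num (nth 0%N j (seq.index k ix))) else x
  | _ => x
  end.

Definition plain_val (v : pval R (base_var S)) : pval R (ivar S) :=
  fun x => if x is Plain y then v y else None.

Definition index_val (i : nat) (v : pval R (base_var S)) : pval R (ivar S) :=
  fun x => if x is Idx y (Num k) then (if k == i then v y else None) else None.

Definition action (e : iexpr) : Type :=
  match e with
  | Direct _ _ => unit
  | Best ix _ _ => seq ((size ix).-tuple nat)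
  | Aggregate ix _ _ _ =>
      {a : R * seq (R * (size ix).-tuple nat) |
        [/\ 0 <= a.1 <= 1, all (fun lj => 0 < lj.1) a.2 &
            \sum_(lj <- a.2) lj.1 = 1]}
  end.

Fixpoint actions (s : seq (Param S * iexpr)) : Type :=
  if s is (_, e) :: s' then (action e * actions s')%type else unit.

Definition weighted_sum (D : seq (R * iterm)) : iterm :=
  foldr (fun lt u => TAdd (TMul (TLit lt.1) lt.2) u) (TLit 0) D.

Definition noise_dists (N : NoiseVar S -> bdist) (t : iterm) :
    seq (ivar S * idist) :=
  pmap (fun x =>
    if x is Idx (No y) (Num l) then
      Some (x, drename (fun z => Idx z (Num l)) (N y)) else None)
    (undup (tvars t)).

Definition instantiate1 (N : NoiseVar S -> bdist) (p : Param S) (e : iexpr) :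
    action e -> seq (Param S * isbi * R) :=
  match e return action e -> _ with
  | Direct t G => fun=> [:: (p, SWhen (STerm t) G, 0)]
  | Best ix t G => fun J =>
      [seq (p, SWhen (STerm (trename (inst_var ix j) t))
                     (rename (inst_var ix j) G), 0)
        | j : (size ix).-tuple nat <- J]
  | Aggregate ix t1 t2 G => fun a =>
      let: (eps, D) := sval a in
      let at_ (lj : R * (size ix).-tuple nat) := inst_var ix lj.2 in
      let u1 := weighted_sum [seq (lj.1, trename (at_ lj) t1) | lj <- D] in
      let u2 := weighted_sum [seq (lj.1, trename (at_ lj) t2) | lj <- D] in
      [:: (p, SWhen (SAdd (STerm u1) (SCdf (noise_dists N u2) u2 (TLit eps)))
                    (bigand [seq rename (at_ lj) G | lj <- D]), eps)]
  end.

Fixpoint instantiate (N : NoiseVar S -> bdist) (s : seq (Param S * iexpr)) :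
    actions s -> seq (Param S * isbi * R) :=
  match s return actions s -> _ with
  | [::] => fun=> [::]
  | (p, e) :: s' => fun a => instantiate1 N p a.1 ++ instantiate N a.2
  end.

Section Obligation.
Variable sp : shield_spec.

Definition var_cond0 (x : base_var S) : bformula :=
  match x with
  | St _ => Inv sp
  | Pa p => Bound sp p
  | Ob w => FCmp CEq (TVar (Ob w)) (Obs sp w)
  | No _ | Aux _ => FTrue
  end.

Definition var_cond (x : ivar S) : iformula :=
  match x with
  | Plain y => rename Plain (var_cond0 y)
  | Idx y i => index_formula i (var_cond0 y)
  end.

Definition obligation1 (p : Param S) (e : iexpr) : iformula :=
  let ob (fv : seq (ivar S)) (G : iformula) (t : iterm) :=
    FImp (FAnd (rename Plain (bigand (Assum sp))) (bigand (map var_cond fv)))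
         (FImp G (subst (Plain (Pa p)) t (rename Plain (Bound sp p)))) in
  match e with
  | Direct t G | Best _ t G => ob (tvars t ++ FV G) G t
  | Aggregate _ t1 t2 G =>
      ob (tvars t1 ++ tvars t2 ++ FV G) G (TAdd t1 t2)
  end.

Definition obligation : iformula :=
  bigand [seq obligation1 pe.1 pe.2 | pe <- Infer sp].

Definition spec_interp (c : Const S -> R)
    (u : forall f : Unknown S, ('I_(arity f) -> R) -> R) :
    interp R (@sym_arity S) :=
  fun f => match f return ('I_(sym_arity f) -> R) -> R with
           | inl k => fun=> c k
           | inr g => u g
           end.

Definition const_interp (c : Const S -> R) : pinterp R (@sym_arity S) :=
  fun f => match f return option (('I_(sym_arity f) -> R) -> R) with
           | inl k => Some (fun=> c k)
           | inr g => None
           end.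

Definition state_val (s : StateVar S -> R) : pval R (base_var S) :=
  fun x => if x is St y then Some (s y) else None.
Definition param_val (b : pval R (Param S)) : pval R (base_var S) :=
  fun x => if x is Pa p then b p else None.
Definition noise_val (eta : NoiseVar S -> R) : pval R (base_var S) :=
  fun x => if x is No y then Some (eta y) else None.

(** Satisfaction in a partial valuation that is defined on the free
   variables. *)
Definition psat (I : interp R (@sym_arity S)) (v : pval R (base_var S))
    (P : bformula) : Prop :=
  all (fun x => isSome (v x)) (FV P) /\ sat I P (total_val v).

Definition Bounds (b : pval R (Param S)) : bformula :=
  bigand (pmap (fun p => omap (fun r => subst (Pa p) (TLit r) (Bound sp p)) (b p))
               (enum (Param S))).

Definition obs_val (I : interp R (@sym_arity S)) (s : StateVar S -> R)
    (eta : NoiseVar S -> R) (z : {set ObsVar S}) : pval R (base_var S) :=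
  fun x =>
    if x is Ob w then
      if w \in z then
        Some (eval I (total_val (vunion (state_val s) (noise_val eta))) (Obs sp w))
      else None
    else None.

Definition sound (impl : cdf_impl R (@sym_arity S) (ivar S))
    (t : Param S * isbi * R) : Prop :=
  let: (p, e, eps) := t in
  forall (c : Const S -> R) (u : forall f : Unknown S, ('I_(arity f) -> R) -> R)
         (n : nat) (s : nat -> StateVar S -> R) (z : nat -> {set ObsVar S})
         (b : nat -> pval R (Param S)),
    (0 < n)%N ->
    (forall i, (1 <= i <= n)%N ->
      (forall q, global_param (Bound sp) q -> Pa q \in FV (Inv sp) ->
         isSome (b i q)) /\
      psat (spec_interp c u) (vunion (state_val (s i)) (param_val (b i)))
        (FAnd (bigand (Assum sp)) (FAnd (Inv sp) (Bounds (b i))))) ->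
    prob_le (fun iy : nat * NoiseVar S => (1 <= iy.1 <= n)%N)
      (fun iy => dist_law (const_interp c) (state_val (s iy.1)) (Noise sp iy.2))
      (fun eta =>
        let o i := obs_val (spec_interp c u) (s i) (fun y => eta (i, y)) (z i) in
        let v := foldr (@vunion R (ivar S))
          (plain_val (vunion (state_val (s n)) (param_val (b n))))
          [seq index_val i (vunion (vunion (state_val (s i)) (param_val (b i))) (o i))
             | i <- iota 1 n] in
        let r := eval_sbi impl (const_interp c) v e in
        ~ psat (spec_interp c u) (state_val (s n)) (Bounds (pupd (b n) p r)))
      eps.

End Obligation.
End Specification.

(* Main.v *)
(** Extend the partial valuation seen by the inference to a total one, [actual],
   that also records the noise and the observations that were not available.  The
   hypotheses on the states and parameters say that [actual], precomposed with the
   instantiation of the symbolic indices, satisfies the premises of the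
   obligation, which therefore gives Bound_p[theta].  In the first two cases the
   violation event is thus empty.  For an aggregate, Bound_p holds at each
   theta_1 + theta_2, hence by upward closure at their weighted mean, so that a
   violation forces the noise sum Y to exceed the computed bound b.  Two points
   remain.  The bound b depends on the observations, hence on the noise; but Y
   is measurable and the admissible bounds form a closed upward ray, so one loses
   nothing.  And Y may involve noise at steps not in 1..n, for which no random
   variable is given; the probability space is enlarged by a product, which does
   not change the outer probability of the violation. *)

From HB Require Import structures.
From Stdlib Require List Relations.
From mathcomp Require Import all_boot all_order all_algebra.
From mathcomp Require Import all_classical all_reals all_analysis.
From mathcomp Require Import measurable_realfun.
Require Import Defs.

Set Implicit Arguments.
Unset Strict Implicit.
Unset Printing Implicit Defensive.

Import Order.TTheory GRing.Theory Num.Theory.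
Import numFieldNormedType.Exports.

Local Open Scope classical_set_scope.
Local Open Scope ring_scope.

Scheme formula_mut_ind := Induction for formula Sort Prop
  with program_mut_ind := Induction for program Sort Prop.
Combined Scheme formula_program_ind from formula_mut_ind, program_mut_ind.

(** * Coincidence, renaming and substitution *)

Section Coincidence.
Variables (R : realType) (F : Type) (ar : F -> nat).
Implicit Types (I J : interp R ar).

(** Two interpretations are compared because the inference sees only the constants, whereas the
    bounds also read the unknowns. *)
Lemma eval_over (V : Type) I J (pf : pred F) (pv : pred V) (s s' : V -> R)
    (t : term R ar V) :
  (forall f, pf f -> I f = J f) -> (forall x, pv x -> s x = s' x) ->
  term_over pf pv t -> eval I s t = eval J s' t.
Proof.
move=> IJ ss'; elim: t => //=.
- by move=> f a IH /andP[/IJ -> /forallP aO]; congr (J f _); apply: funext => i;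
    exact: IH.
- by move=> t IH /IH ->.
- by move=> t IHt u IHu /andP[/IHt -> /IHu ->].
- by move=> t IHt u IHu /andP[/IHt -> /IHu ->].
- by move=> t IHt u IHu /andP[/IHt -> /IHu ->].
- by move=> t IHt u IHu /andP[/IHt -> /IHu ->].
Qed.

Lemma sat_qf_over (V : eqType) I J (pf : pred F) (pv : pred V) (s s' : V -> R)
    (P : formula R ar V) :
  (forall f, pf f -> I f = J f) -> (forall x, pv x -> s x = s' x) ->
  qf_over pf pv P -> sat I P s <-> sat J P s'.
Proof.
move=> IJ ss'; elim: P => //=.
- by move=> c t u /andP[tO uO]; rewrite !(eval_over IJ ss').
- by move=> P IH /IH ->.
- by move=> P IHP Q IHQ /andP[/IHP -> /IHQ ->].
- by move=> P IHP Q IHQ /andP[/IHP -> /IHQ ->].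
- by move=> P IHP Q IHQ /andP[/IHP PO /IHQ QO]; split=> h /PO/h/QO.
- by move=> P IHP Q IHQ /andP[/IHP -> /IHQ ->].
Qed.

Lemma term_overP (V : eqType) (pf : pred F) (pv : pred V) (t : term R ar V) :
  term_over pf pv t -> {in tvars t, forall x, pv x}.
Proof.
elim: t => //=.
- by move=> x px y; rewrite inE => /eqP ->.
- move=> f a IH /andP[_ /forallP aO] x /flatten_mapP[i _ xi].
  exact: (IH i (aO i)).
- by move=> t IHt u IHu /andP[tO uO] x; rewrite mem_cat => /orP[/IHt|/IHu]; apply.
- by move=> t IHt u IHu /andP[tO uO] x; rewrite mem_cat => /orP[/IHt|/IHu]; apply.
- by move=> t IHt u IHu /andP[tO uO] x; rewrite mem_cat => /orP[/IHt|/IHu]; apply.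
- by move=> t IHt u IHu /andP[tO uO] x; rewrite mem_cat => /orP[/IHt|/IHu]; apply.
Qed.

Lemma qf_overP (V : eqType) (pf : pred F) (pv : pred V) (P : formula R ar V) :
  qf_over pf pv P -> {in FV P, forall x, pv x}.
Proof.
elim: P => //=.
- by move=> c t u /andP[/term_overP tO /term_overP uO] x;
    rewrite mem_cat => /orP[/tO|/uO].
- by move=> P IHP Q IHQ /andP[PO QO] x; rewrite mem_cat => /orP[/IHP|/IHQ]; apply.
- by move=> P IHP Q IHQ /andP[PO QO] x; rewrite mem_cat => /orP[/IHP|/IHQ]; apply.
- by move=> P IHP Q IHQ /andP[PO QO] x; rewrite mem_cat => /orP[/IHP|/IHQ]; apply.
- by move=> P IHP Q IHQ /andP[PO QO] x; rewrite mem_cat => /orP[/IHP|/IHQ]; apply.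
Qed.

Lemma eval_coincidence (V : eqType) I (s s' : V -> R) (t : term R ar V) :
  {in tvars t, s =1 s'} -> eval I s t = eval I s' t.
Proof.
elim: t => //=.
- by move=> x; apply; rewrite inE.
- move=> f a IH ss'; congr (I f _); apply: funext => i; apply: IH => x xi.
  by apply: ss'; apply/flatten_mapP; exists i; rewrite ?mem_enum.
- by move=> t IH /IH ->.
- by move=> t IHt u IHu ss'; congr (_ + _); [apply: IHt|apply: IHu] => x xt;
    apply: ss'; rewrite mem_cat xt ?orbT.
- by move=> t IHt u IHu ss'; congr (_ * _); [apply: IHt|apply: IHu] => x xt;
    apply: ss'; rewrite mem_cat xt ?orbT.
- by move=> t IHt u IHu ss'; congr (Num.min _ _); [apply: IHt|apply: IHu] => x xt;
    apply: ss'; rewrite mem_cat xt ?orbT.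
- by move=> t IHt u IHu ss'; congr (Num.max _ _); [apply: IHt|apply: IHu] => x xt;
    apply: ss'; rewrite mem_cat xt ?orbT.
Qed.

Lemma List_In_unzip1 (A : eqType) (B : Type) (s : seq (A * B)) x y :
  List.In (x, y) s -> x \in unzip1 s.
Proof.
elim: s => //= -[x' y'] s IH [[-> _]|/IH]; first by rewrite mem_head.
by rewrite inE => ->; rewrite orbT.
Qed.

Lemma List_In_tvars (V : eqType) (s : seq (V * term R ar V)) x e :
  List.In (x, e) s -> {subset tvars e <= flatten [seq tvars xt.2 | xt <- s]}.
Proof.
elim: s => //= -[x' e'] s IH [[_ ->]|/IH sub] y ye; rewrite mem_cat ?ye//.
by rewrite sub ?orbT.
Qed.

(** [D] may exceed [FVp a] because, in a sequence, the second program reads variables that only the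
    first has written. Variables in [MBV a] end up equal even where the initial states differ, since
    every run overwrites them. *)
Lemma coincidence (V : eqType) I :
  (forall (P : formula R ar V) (s s' : V -> R),
     {in FV P, s =1 s'} -> sat I P s <-> sat I P s') /\
  (forall (a : program R ar V) (D : {pred V}) (s t s' : V -> R),
     {subset FVp a <= D} -> {in D, s =1 t} -> run I a s s' ->
     exists2 t', run I a t t' &
       forall x, (x \in D) || (x \in MBV a) -> s' x = t' x).
Proof.
apply: formula_program_ind => //=.
- move=> c t u s s' ss'.
  by rewrite !(@eval_coincidence _ I s s')// => x xt; apply: ss';
    rewrite mem_cat xt ?orbT.
- by move=> P IH s s' /IH ->.
- move=> P IHP Q IHQ s s' ss'.
  by rewrite (IHP s s') ?(IHQ s s')// => x xt; apply: ss'; rewrite mem_cat xt ?orbT.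
- move=> P IHP Q IHQ s s' ss'.
  by rewrite (IHP s s') ?(IHQ s s')// => x xt; apply: ss'; rewrite mem_cat xt ?orbT.
- move=> P IHP Q IHQ s s' ss'.
  have hP : sat I P s <-> sat I P s'.
    by apply: IHP => x xt; apply: ss'; rewrite mem_cat xt.
  have hQ : sat I Q s <-> sat I Q s'.
    by apply: IHQ => x xt; apply: ss'; rewrite mem_cat xt orbT.
  by split=> h /hP/h/hQ.
- move=> P IHP Q IHQ s s' ss'.
  by rewrite (IHP s s') ?(IHQ s s')// => x xt; apply: ss'; rewrite mem_cat xt ?orbT.
- move=> x P IH s s' ss'.
  have h r : sat I P (upd s x r) <-> sat I P (upd s' x r).
    apply: IH => y yP; rewrite /upd; case: eqVneq => // yx.
    by apply: ss'; rewrite mem_filter yx.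
  by split=> H r; apply/h.
- move=> x P IH s s' ss'.
  have h r : sat I P (upd s x r) <-> sat I P (upd s' x r).
    apply: IH => y yP; rewrite /upd; case: eqVneq => // yx.
    by apply: ss'; rewrite mem_filter yx.
  by split=> -[r H]; exists r; apply/h.
- move=> a IHa P IH s s' ss'.
  suff h (u u' : V -> R) : {in FVp a ++ [seq y <- FV P | y \notin MBV a], u =1 u'} ->
      (forall v, run I a u v -> sat I P v) -> forall v, run I a u' v -> sat I P v.
    by split; apply: h => // x /ss'.
  move=> uu' H v uv.
  have [||v' uv' vv'] := IHa [in FVp a ++ [seq y <- FV P | y \notin MBV a]] u' u v _ _ uv.
  - by move=> x xa; rewrite unfold_in mem_cat xa.
  - by move=> x xa; rewrite uu'.
  apply/(IH v v'); last exact: H.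
  move=> x xP; apply: vv'; rewrite mem_cat mem_filter xP andbT.
  by case: (x \in MBV a); rewrite ?orbT.
- move=> a IHa P IH s s' ss'.
  suff h (u u' : V -> R) : {in FVp a ++ [seq y <- FV P | y \notin MBV a], u =1 u'} ->
      (exists v, run I a u v /\ sat I P v) -> exists v, run I a u' v /\ sat I P v.
    by split; apply: h => // x /ss'.
  move=> uu' [v [uv Pv]].
  have [||v' uv' vv'] := IHa [in FVp a ++ [seq y <- FV P | y \notin MBV a]] u u' v _ _ uv.
  - by move=> x xa; rewrite unfold_in mem_cat xa.
  - by move=> x xa; rewrite uu'.
  exists v'; split=> //; apply/(IH v v') => // x xP.
  apply: vv'; rewrite mem_cat mem_filter xP andbT.
  by case: (x \in MBV a); rewrite ?orbT.
- move=> x e D s t s' sub st ->; exists (upd t x (eval I t e)) => // y.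
  rewrite inE /upd; case: eqVneq => [_ _|_]; last by rewrite orbF => /st.
  by apply: eval_coincidence => z /sub/st.
- move=> x D s t s' _ st [r ->]; exists (upd t x r); first by exists r.
  by move=> y; rewrite inE /upd; case: eqVneq => // _; rewrite orbF => /st.
- move=> Q IH D s t s' sub st [-> Qs]; exists t; last first.
    by move=> x; rewrite orbF => /st.
  by split=> //; apply/(IH s t) => // x /sub/st.
- move=> sys Q IH D s t s' sub st [T [phi [T0 phi0 phiT phiP]]].
  (* The variables of the system follow the old solution, all others stay at [t]. The former are
     free in the program, so the initial values match. *)
  pose psi r x := if x \in unzip1 sys then phi r x else t x.
  have subsys : {subset unzip1 sys <= D}.
    by move=> x xs; apply: sub; rewrite mem_cat xs.
  have phiD r x : 0 <= r <= T -> x \in D -> phi r x = psi r x.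
    move=> rT xD; rewrite /psi; case: ifPn => // xs.
    by have [_ ->// _] := phiP _ rT; rewrite st.
  exists (psi T).
    exists T, psi; split=> //.
      apply: funext => x; rewrite /psi; case: ifPn => // /subsys/st <-.
      by rewrite phi0.
    move=> r rT; have [Qr off der] := phiP _ rT; split.
    - apply/(IH (phi r)) => // x xQ; apply: phiD => //.
      by apply: sub; rewrite !mem_cat xQ !orbT.
    - by move=> x xs; rewrite /psi (negbTE xs).
    - move=> x e xe; rewrite -(@eval_coincidence _ I (phi r)); last first.
        move=> y ye; apply: phiD => //; apply: sub.
        by rewrite !mem_cat (List_In_tvars xe ye) !orbT.
      by have := der _ _ xe; rewrite /psi (List_In_unzip1 xe).
  move=> x; rewrite -phiT => xs; apply: phiD; first by rewrite T0 lexx.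
  by case/orP: xs => // /subsys.
- move=> a IHa b IHb D s t s' sub st [ss'|ss'].
  + have [||t' tt' st'] := IHa D s t s' _ _ ss' => //.
      by move=> x xa; apply: sub; rewrite mem_cat xa.
    exists t'; first by left.
    by move=> x; rewrite mem_filter => /orP[xD|/andP[xa xb]]; apply: st';
      rewrite ?xD ?xa ?xb ?orbT.
  + have [||t' tt' st'] := IHb D s t s' _ _ ss' => //.
      by move=> x xa; apply: sub; rewrite mem_cat xa orbT.
    exists t'; first by right.
    by move=> x; rewrite mem_filter => /orP[xD|/andP[xa xb]]; apply: st';
      rewrite ?xD ?xa ?xb ?orbT.
- move=> a IHa b IHb D s t s' sub st [s1 [ss1 s1s']].
  have [||t1 tt1 st1] := IHa D s t s1 _ _ ss1 => //.
    by move=> x xa; apply: sub; rewrite mem_cat xa.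
  have [||t' t1t' st'] :=
    IHb [pred x | (x \in D) || (x \in MBV a)] s1 t1 s' _ _ s1s' => //.
    move=> x xb; rewrite inE; case: (boolP (x \in MBV a)) => xa; rewrite ?orbT//.
    by rewrite sub// mem_cat mem_filter xa xb orbT.
  exists t'; first by exists t1.
  by move=> x; rewrite mem_cat orbA => xx; apply: st'.
(* [MBV] of a loop is empty; agreement on the fixed set [D] is the invariant of the iterations. *)
- move=> a IHa D s t s' sub st ss'; elim: ss' t st => {s s'} [s|s s1 s' ss1 _ IH] t st.
    by exists t; [exact: Relation_Operators.rt1n_refl|move=> x; rewrite orbF => /st].
  have [||t1 tt1 st1] := IHa D s t s1 _ _ ss1 => //.
  have [|t' t1t' st'] := IH t1; first by move=> x xD; apply: st1; rewrite xD.
  by exists t' => //; apply: Relation_Operators.rt1n_trans tt1 t1t'.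
Qed.

Lemma sat_coincidence (V : eqType) I (P : formula R ar V) (s s' : V -> R) :
  {in FV P, s =1 s'} -> sat I P s <-> sat I P s'.
Proof. exact: (proj1 (coincidence V I)). Qed.

Lemma sat_agree (V : eqType) I (P : formula R ar V) (s s' : V -> R) :
  sat I P s -> {in FV P, s =1 s'} -> sat I P s'.
Proof. by move=> Ps /(sat_coincidence I)[+ _]; apply. Qed.

(** * Renaming of variables *)

Lemma eval_rename (V W : Type) I (h : V -> W) (s : W -> R) (t : term R ar V) :
  eval I s (trename h t) = eval I (s \o h) t.
Proof.
elim: t => //=.
- by move=> f a IH; congr (I f _); apply: funext.
- by move=> t ->.
- by move=> t -> u ->.
- by move=> t -> u ->.
- by move=> t -> u ->.
- by move=> t -> u ->.
Qed.

Lemma sat_rename_qf (V W : eqType) I (h : V -> W) (s : W -> R) (P : formula R ar V) :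
  qf P -> sat I (rename h P) s <-> sat I P (s \o h).
Proof.
rewrite /qf; elim: P => //=.
- by move=> c t u _; rewrite !eval_rename.
- by move=> P IH /IH ->.
- by move=> P IHP Q IHQ /andP[/IHP -> /IHQ ->].
- by move=> P IHP Q IHQ /andP[/IHP -> /IHQ ->].
- by move=> P IHP Q IHQ /andP[/IHP PO /IHQ QO]; split=> k /PO/k/QO.
- by move=> P IHP Q IHQ /andP[/IHP -> /IHQ ->].
Qed.

Lemma tvars_rename (V W : eqType) (h : V -> W) (t : term R ar V) :
  tvars (trename h t) = map h (tvars t).
Proof.
elim: t => //=.
- move=> f a IH; rewrite map_flatten -map_comp; congr flatten.
  by apply: eq_map => i /=.
- by move=> t -> u ->; rewrite map_cat.
- by move=> t -> u ->; rewrite map_cat.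
- by move=> t -> u ->; rewrite map_cat.
- by move=> t -> u ->; rewrite map_cat.
Qed.

Lemma FV_rename_qf (V W : eqType) (h : V -> W) (P : formula R ar V) :
  qf P -> FV (rename h P) = map h (FV P).
Proof.
rewrite /qf; elim: P => //=.
- by move=> c t u _; rewrite !tvars_rename map_cat.
- by move=> P IHP Q IHQ /andP[/IHP -> /IHQ ->]; rewrite map_cat.
- by move=> P IHP Q IHQ /andP[/IHP -> /IHQ ->]; rewrite map_cat.
- by move=> P IHP Q IHQ /andP[/IHP -> /IHQ ->]; rewrite map_cat.
- by move=> P IHP Q IHQ /andP[/IHP -> /IHQ ->]; rewrite map_cat.
Qed.

(** Lifts a state of the original program to one of the renamed program. The preimage is picked by
    choice, which is harmless when [h] is injective ([overlay_comp]). *)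
Definition overlay (V W : Type) (h : V -> W) (s : W -> R) (u : V -> R) : W -> R :=
  fun y => if pselect (exists x, h x = y) is left e then u (sval (cid e)) else s y.

Lemma overlay_comp (V W : Type) (h : V -> W) (s : W -> R) (u : V -> R) :
  injective h -> overlay h s u \o h = u.
Proof.
move=> hI; apply: funext => x /=; rewrite /overlay; case: pselect => [e|[]].
  by congr u; apply: hI; exact: (svalP (cid e)).
by exists x.
Qed.

Lemma overlay_out (V W : Type) (h : V -> W) (s : W -> R) (u : V -> R) y :
  ~ (exists x, h x = y) -> overlay h s u y = s y.
Proof. by rewrite /overlay; case: pselect. Qed.

Lemma eq_off_image (V W : Type) (h : V -> W) (s s' : W -> R) :
  s \o h = s' \o h -> (forall y, ~ (exists x, h x = y) -> s' y = s y) -> s = s'.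
Proof.
move=> ss' out; apply: funext => y; case: (pselect (exists x, h x = y)).
  by case=> x <-; have := congr1 (@^~ x) ss'.
by move/out.
Qed.

Lemma upd_comp (V W : eqType) (h : V -> W) (s : W -> R) x r :
  injective h -> upd s (h x) r \o h = upd (s \o h) x r.
Proof. by move=> hI; apply: funext => y; rewrite /upd /= (inj_eq hI). Qed.

Lemma List_In_map (A B : Type) (f : A -> B) s y :
  List.In y [seq f x | x <- s] <-> exists2 x, List.In x s & f x = y.
Proof.
elim: s => /= [|x s IH]; first by split=> // -[].
rewrite IH; split.
  by case=> [<-|[z zs <-]]; [exists x; [left|]|exists z; [right|]].
by case=> z [<-|zs] <-; [left|right; exists z].
Qed.

(** A renamed program writes only to the image of [h]; the frame condition records this, since
    pulling back along [h] forgets the values off the image. Injectivity keeps an update from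
    touching two variables at once. *)
Lemma rename_sat_run (V W : eqType) I (h : V -> W) : injective h ->
  (forall (P : formula R ar V) (s : W -> R),
     sat I (rename h P) s <-> sat I P (s \o h)) /\
  (forall (a : program R ar V) (s s' : W -> R),
     run I (prename h a) s s' <->
     run I a (s \o h) (s' \o h) /\
     (forall y, ~ (exists x, h x = y) -> s' y = s y)).
Proof.
move=> hI; apply: formula_program_ind => //=.
- by move=> c t u s; rewrite !eval_rename.
- by move=> P IH s; rewrite IH.
- by move=> P IHP Q IHQ s; rewrite IHP IHQ.
- by move=> P IHP Q IHQ s; rewrite IHP IHQ.
- by move=> P IHP Q IHQ s; split=> k /IHP/k/IHQ.
- by move=> P IHP Q IHQ s; rewrite IHP IHQ.
- move=> x P IH s; split=> H r.
    by rewrite -upd_comp//; apply/IH.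
  by apply/IH; rewrite upd_comp.
- move=> x P IH s; split=> -[r H]; exists r.
    by rewrite -upd_comp//; apply/IH.
  by apply/IH; rewrite upd_comp.
- move=> a IHa P IH s; split=> H u.
    move=> au; rewrite -(overlay_comp s u hI); apply/IH; apply: H; apply/IHa.
    by rewrite overlay_comp//; split=> // y; exact: overlay_out.
  by move/IHa => [au _]; apply/IH; exact: H.
- move=> a IHa P IH s; split=> -[u [au Pu]].
    by exists (u \o h); split; [have /IHa[] := au|apply/IH].
  exists (overlay h s u); split.
    by apply/IHa; rewrite overlay_comp//; split=> // y; exact: overlay_out.
  by apply/IH; rewrite overlay_comp.
- move=> x t s s'; rewrite eval_rename; split.
    move=> ->; rewrite upd_comp//; split=> // y yh.
    by rewrite /upd; case: eqVneq => // yx; case: yh; exists x.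
  case=> ss' out; apply/esym; apply: (@eq_off_image _ _ h).
    by rewrite upd_comp.
  move=> y yh; rewrite out// /upd; case: eqVneq => // yx.
  by case: yh; exists x.
- move=> x s s'; split.
    move=> [r ->]; rewrite upd_comp//; split=> [|y yh]; first by exists r.
    by rewrite /upd; case: eqVneq => // yx; case: yh; exists x.
  case=> -[r ss'] out; exists r; apply/esym; apply: (@eq_off_image _ _ h).
    by rewrite upd_comp.
  move=> y yh; rewrite out// /upd; case: eqVneq => // yx.
  by case: yh; exists x.
- move=> Q IH s s'; rewrite IH; split=> [[-> Qs]//|[[ss' Qs] out]].
  by split=> //; apply/esym/(@eq_off_image _ _ h).
- move=> sys Q IH s s'.
  have sysE : unzip1 [seq (h xt.1, trename h xt.2) | xt <- sys] = map h (unzip1 sys).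
    by rewrite /unzip1 -!map_comp.
  split.
    case=> T [phi [T0 phi0 phiT phiP]]; split; last first.
      move=> y yh; rewrite -phiT; have [|_ -> //] := phiP T; first by rewrite T0 lexx.
      by rewrite sysE; apply/mapP => -[x _ yx]; apply: yh; exists x.
    exists T, (fun r => phi r \o h); split=> //; [by rewrite phi0|by rewrite phiT|].
    move=> r /phiP[Qr off der]; split.
    + exact/IH.
    + by move=> x xs /=; apply: off; rewrite sysE mem_map.
    + move=> x e xe; rewrite -eval_rename; apply: der.
      by apply/List_In_map; exists (x, e).
  case=> -[T [phi [T0 phi0 phiT phiP]]] out.
  exists T, (fun r => overlay h s (phi r)); split=> //.
  + apply/esym/(@eq_off_image _ _ h); first by rewrite overlay_comp.
    by move=> y; exact: overlay_out.
  + apply: (@eq_off_image _ _ h); first by rewrite overlay_comp.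
    by move=> y yh; rewrite overlay_out// out.
  move=> r /phiP[Qr off der]; split.
  + by apply/IH; rewrite overlay_comp.
  + rewrite sysE => y yS; case: (pselect (exists x, h x = y)) => [[x xy]|yh].
      rewrite -xy in yS *; rewrite -[LHS]/((_ \o h) x) overlay_comp// off//.
      by apply: contra yS => ?; rewrite mem_map.
    by rewrite overlay_out.
  + move=> y e /List_In_map[[x e'] /der + [<- <-]].
    rewrite eval_rename overlay_comp//.
    by under [X in X @ _ --> _ -> _]eq_fun do
      rewrite -(overlay_comp s (phi _) hI) -(overlay_comp s (phi r) hI).
- by move=> a IHa b IHb s s'; rewrite IHa IHb; tauto.
- move=> a IHa b IHb s s'; split.
    case=> u [/IHa[su out] /IHb[us' out']]; split; first by exists (u \o h).
    by move=> y yh; rewrite out' ?out.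
  case=> -[u [su us']] out; exists (overlay h s u); split.
    by apply/IHa; rewrite overlay_comp//; split=> // y; exact: overlay_out.
  by apply/IHb; rewrite overlay_comp//; split=> // y yh; rewrite overlay_out ?out.
- move=> a IHa s s'; split.
    elim=> {s s'} [s|s u s' /IHa[su out] _ [us' out']].
      by split=> //; exact: Relation_Operators.rt1n_refl.
    split; first by apply: Relation_Operators.rt1n_trans su us'.
    by move=> y yh; rewrite out' ?out.
  (* The induction is on the run of [a], whose end points must first be made variables; intermediate
     states are lifted by [overlay]. *)
  have [s0 s0E] : exists s0, s0 = s \o h by exists (s \o h).
  have [s1 s1E] : exists s1, s1 = s' \o h by exists (s' \o h).
  rewrite -s0E -s1E => -[H]; elim: H s s' s0E s1E => {s0 s1}.
    move=> s0 s s' -> ss' out; rewrite (eq_off_image ss' out).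
    exact: Relation_Operators.rt1n_refl.
  move=> s0 u s1 su _ IH s s' s0E s1E out.
  have ov : run I (prename h a) s (overlay h s u).
    by apply/IHa; rewrite overlay_comp// -s0E; split=> // y; exact: overlay_out.
  apply: Relation_Operators.rt1n_trans ov _; apply: IH => //.
    by rewrite overlay_comp.
  by move=> y yh; rewrite overlay_out ?out.
Qed.

Lemma sat_rename (V W : eqType) I (h : V -> W) (P : formula R ar V) (s : W -> R) :
  injective h -> sat I (rename h P) s <-> sat I P (s \o h).
Proof. by move=> /(@rename_sat_run V W I)[]. Qed.

(** * Substitution and finite conjunctions *)

Lemma eval_tsubst (V : eqType) I (p : V) (e t : term R ar V) s :
  eval I s (tsubst p e t) = eval I (upd s p (eval I s e)) t.
Proof.
elim: t => //=.
- by move=> x; rewrite /upd; case: eqP.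
- by move=> f a IH; congr (I f _); apply: funext.
- by move=> t ->.
- by move=> t -> u ->.
- by move=> t -> u ->.
- by move=> t -> u ->.
- by move=> t -> u ->.
Qed.

(** Binding a variable other than [p] and absent from [e] commutes with the update. Where capture
    threatens and under modalities, [subst] leaves the assignment [p := e], whose only run is that
    update. *)
Lemma sat_subst (V : eqType) I (p : V) (e : term R ar V) (P : formula R ar V) s :
  sat I (subst p e P) s <-> sat I P (upd s p (eval I s e)).
Proof.
have updpp (t : V -> R) r r' : upd (upd t p r) p r' = upd t p r'.
  by apply: funext => y; rewrite /upd; case: eqP.
have updC (t : V -> R) x r r' : x != p ->
    upd (upd t p r) x r' = upd (upd t x r') p r.
  move=> xp; apply: funext => y; rewrite /upd; case: eqP => // ->.
  by rewrite (negbTE xp).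
have evalx (t : V -> R) x r : x \notin tvars e -> eval I (upd t x r) e = eval I t e.
  move=> xe; apply: eval_coincidence => y ye; rewrite /upd; case: eqP => // yx.
  by rewrite -yx ye in xe.
have box (Q : formula R ar V) t : sat I (FBox (PAssign p e) Q) t <->
    sat I Q (upd t p (eval I t e)) by split=> [|H u /= ->//]; apply.
elim: P s => //=.
- by move=> c t u s; rewrite !eval_tsubst.
- by move=> P IH s; rewrite IH.
- by move=> P IHP Q IHQ s; rewrite IHP ?IHQ.
- by move=> P IHP Q IHQ s; rewrite IHP ?IHQ.
- by move=> P IHP Q IHQ s; split=> k /IHP H; apply/IHQ/k.
- by move=> P IHP Q IHQ s; rewrite IHP ?IHQ.
- move=> x P IH s; case: eqVneq => [->|xp].
    by split=> /= H r; move: (H r); rewrite updpp.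
  case: ifPn => xe; first exact: (box (FAll x P)).
  by split=> H r; [rewrite updC// -(evalx _ x r xe); apply/IH
                  |apply/IH; rewrite evalx// -updC].
- move=> x P IH s; case: eqVneq => [->|xp].
    by split=> /= -[r H]; exists r; move: H; rewrite updpp.
  case: ifPn => xe; first exact: (box (FEx x P)).
  by split=> -[r H]; exists r; [rewrite updC// -(evalx _ x r xe); apply/IH
                  |apply/IH; rewrite evalx// -updC].
- by move=> a P _ s; exact: (box (FBox a P) s).
- by move=> a P _ s; exact: (box (FDia a P) s).
Qed.

(** Serves to show that an instantiated bound has only state variables free, as [psat] demands.
    Under a modality [p] vanishes because the assignment binds it. *)
Lemma FV_subst_lit (V : eqType) (p : V) (r : R) (P : formula R ar V) x :
  x \in FV (subst p (TLit r) P) -> (x \in FV P) && (x != p).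
Proof.
have tv (t : term R ar V) :
    x \in tvars (tsubst p (TLit r) t) -> (x \in tvars t) && (x != p).
  elim: t => //=.
  - move=> y; case: eqVneq => //= yp; rewrite !inE => /eqP ->.
    by rewrite eqxx.
  - move=> f a IH /flatten_mapP[i _ /IH /andP[xi ->]]; rewrite andbT.
    by apply/flatten_mapP; exists i; rewrite ?mem_enum.
  - by move=> t IHt u IHu; rewrite !mem_cat => /orP[/IHt|/IHu] /andP[-> ->];
      rewrite ?orbT.
  - by move=> t IHt u IHu; rewrite !mem_cat => /orP[/IHt|/IHu] /andP[-> ->];
      rewrite ?orbT.
  - by move=> t IHt u IHu; rewrite !mem_cat => /orP[/IHt|/IHu] /andP[-> ->];
      rewrite ?orbT.
  - by move=> t IHt u IHu; rewrite !mem_cat => /orP[/IHt|/IHu] /andP[-> ->];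
      rewrite ?orbT.
elim: P => //=.
- by move=> c t u; rewrite !mem_cat => /orP[/tv|/tv] /andP[-> ->]; rewrite ?orbT.
- by move=> P IHP Q IHQ; rewrite !mem_cat => /orP[/IHP|/IHQ] /andP[-> ->];
    rewrite ?orbT.
- by move=> P IHP Q IHQ; rewrite !mem_cat => /orP[/IHP|/IHQ] /andP[-> ->];
    rewrite ?orbT.
- by move=> P IHP Q IHQ; rewrite !mem_cat => /orP[/IHP|/IHQ] /andP[-> ->];
    rewrite ?orbT.
- by move=> P IHP Q IHQ; rewrite !mem_cat => /orP[/IHP|/IHQ] /andP[-> ->];
    rewrite ?orbT.
- move=> y P IH; case: eqVneq => [->|yp] /=.
    by rewrite !mem_filter => /andP[-> ->].
  by rewrite !mem_filter => /andP[-> /IH].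
- move=> y P IH; case: eqVneq => [->|yp] /=.
    by rewrite !mem_filter => /andP[-> ->].
  by rewrite !mem_filter => /andP[-> /IH].
- by move=> a P _; rewrite mem_filter inE => /andP[-> ->].
- by move=> a P _; rewrite mem_filter inE => /andP[-> ->].
Qed.

Lemma sat_bigand (V : eqType) I (s : seq (formula R ar V)) v :
  sat I (bigand s) v <-> forall P, List.In P s -> sat I P v.
Proof.
elim: s => [|P s IH] /=; first by split.
split=> [[Pv /IH sv] Q [<-//|/sv]//|H]; split; first by apply: H; left.
by apply/IH => Q Qs; apply: H; right.
Qed.

Lemma FV_bigand (V : eqType) (s : seq (formula R ar V)) x :
  x \in FV (bigand s) <-> exists2 P, List.In P s & x \in FV P.
Proof.
elim: s => [|P s IH] /=; first by split=> // -[].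
rewrite mem_cat; split.
  by case/orP=> [xP|/IH[Q Qs xQ]]; [exists P => //; left|exists Q => //; right].
by case=> Q [<- ->//|Qs xQ]; apply/orP; right; apply/IH; exists Q.
Qed.

Lemma qf_over_bigand (V : eqType) (pf : pred F) (pv : pred V)
    (s : seq (formula R ar V)) P :
  qf_over pf pv (bigand s) -> List.In P s -> qf_over pf pv P.
Proof. by elim: s => //= Q s IH /andP[Qo so] [<-//|/IH]; apply. Qed.

End Coincidence.

(** * Outer probabilities of events *)

Section ProbLe.
Variable R : realType.
Local Notation realprob := (probability (measurableTypeR R) R).

(** [R] and [measurableTypeR R] carry distinct, convertible measurable structures. *)
Lemma measurable_RV d (T : measurableType d) (P : probability T R)
    (X : {RV P >-> measurableTypeR R}) : measurable_fun [set: T] (X : T -> R).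
Proof. have mX := @measurable_funPT _ _ _ _ X; exact mX. Qed.

(** Enlarging the index set restricts the families over which [prob_le] quantifies, so an estimate
    for the smaller set persists. *)
Lemma prob_le_mono (J : eqType) (D D' : pred J) (law law' : J -> option realprob)
    (E E' : (J -> R) -> Prop) r :
  {subset D <= D'} -> {in D, law =1 law'} -> (forall eta, E' eta -> E eta) ->
  prob_le D law E r -> prob_le D' law' E' r.
Proof.
move=> DD' ll' E'E H d T P X Xind Xlaw.
apply: le_trans (H d T P X _ _).
- by apply: le_mu_ext => w /E'E.
- by move=> s A us /allP sD mA; apply: Xind => //; apply/allP => j /sD /DD'.
- by move=> j mu Dj lj; apply: Xlaw; [exact: DD'|rewrite -ll'].
Qed.

(** The [b] with P (Y > b) <= r form a closed upward ray, so that [b] may be chosen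
   as a function of the outcome. *)
Lemma prob_le_exists (J : eqType) (D : pred J) (law : J -> option realprob)
    (Y : (J -> R) -> R) (B : set R) (r : R) :
  0 <= r ->
  (forall d (T : measurableType d) (X : J -> T -> R),
     (forall j, measurable_fun [set: T] (X j)) ->
     measurable_fun [set: T] (fun w => Y (fun j => X j w))) ->
  (forall b, B b -> prob_le D law (fun eta => Y eta > b) r) ->
  prob_le D law (fun eta => exists2 b, B b & Y eta > b) r.
Proof.
move=> r0 mY BP d T P X Xind Xlaw.
pose g w := Y (fun j => X j w).
have mg : measurable_fun [set: T] g.
  by apply: (mY _ _ (fun j w => X j w)) => j; exact: measurable_RV.
have mgt c : measurable [set w | g w > c].
  rewrite [X in measurable X](_ : _ = setT `&` g @^-1` `]c, +oo[); first exact: mg.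
  by apply/seteqP; split=> w /=; rewrite in_itv /= andbT => // -[].
have [->|/set0P[b0 Bb0]] := eqVneq B set0.
  rewrite (_ : [set _ | _] = set0); last by apply/seteqP; split=> w // -[].
  by rewrite mu_ext0 // lee_fin.
(* A decreasing sequence tending to the infimum of [B], or to minus infinity, with an admissible
   bound below each term. It turns the event into an increasing union of measurable events. *)
have [c [cnd cP cB]] : exists c : nat -> R,
    [/\ {homo c : m n / (m <= n)%N >-> n <= m},
        forall n, exists2 b, B b & b <= c n &
        forall b x, B b -> b < x -> exists n, c n < x].
  have [lB|nlB] := pselect (has_lbound B).
    exists (fun n => inf B + n.+1%:R^-1); split.
    - by move=> m n mn; rewrite lerD2l lef_pV2 ?posrE// ler_nat.
    - move=> n; have [] := @inf_adherent _ B n.+1%:R^-1.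
      + by rewrite invr_gt0.
      + by split=> //; exists b0.
      + by move=> b Bb /ltW; exists b.
    - move=> b x Bb bx; have [n nP] := ltr_add_invr bx.
      exists n; apply: le_lt_trans nP; rewrite lerD2r; exact: ge_inf.
  exists (fun n => - n%:R); split.
  - by move=> m n mn; rewrite lerN2 ler_nat.
  - move=> n; apply: contrapT => H; apply: nlB; exists (- n%:R) => b Bb.
    by rewrite leNgt; apply/negP => /ltW bn; apply: H; exists b.
  - move=> b x _ _; exists (Num.truncn `|x|).+1; rewrite ltrNl.
    by apply: le_lt_trans (truncnS_gt _); rewrite -normrN ler_norm.
have -> : [set w | exists2 b, B b & b < g w] = \bigcup_n [set w | c n < g w].
  apply/seteqP; split=> [w [b Bb bg]|w [n _ /=]].
    by have [n] := cB _ _ Bb bg; exists n.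
  by have [b Bb bn] := cP n => ng; exists b => //; exact: le_lt_trans ng.
have mU : measurable (\bigcup_n [set w | c n < g w]) by exact: bigcup_measurable.
rewrite (measurable_mu_extE _ mU).
(* Continuity from below reduces the claim to each [c n], where an admissible [b <= c n] gives the
   estimate. *)
have := @nondecreasing_cvg_mu _ _ _ P (fun n => [set w | c n < g w])
  (fun n => mgt (c n)) mU.
move=> /(_ _)/cvg_lim => <- //; last first.
  by move=> m n mn; apply/subsetPset => w /= ; apply: le_lt_trans; exact: cnd.
apply: lime_le.
  apply: ereal_nondecreasing_is_cvgn => m n mn; apply: le_measure; rewrite ?inE//.
  by move=> w /=; apply: le_lt_trans; exact: cnd.
apply: nearW => n /=; have [b Bb bn] := cP n.
rewrite -(measurable_mu_extE P (mgt (c n))).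
apply: le_trans (BP b Bb d T P X Xind Xlaw).
by apply: le_mu_ext => w /=; exact: le_lt_trans.
Qed.

(** Let [U] be the union of a countable measurable cover of the cylinder. Over each point of [F] the
    section of [U] is the whole of [T2], of mass 1, and the mass of [U] is the integral of its
    section masses. *)
Lemma mu_ext_cylinder d1 d2 (T1 : measurableType d1) (T2 : measurableType d2)
    (P : probability T1 R) (Q : probability T2 R) (F : set T1) :
  (mu_ext P F <= mu_ext (P \x Q)%E (F `*` setT))%E.
Proof.
apply: le_ereal_inf_tmp => _ [C [mC FC] <-].
have mU : measurable (\bigcup_n C n) by exact: bigcup_measurable.
pose U := \bigcup_n C n.
apply: (@le_trans _ _ ((P \x Q)%E U)); last first.
  exact: (@measure_sigma_subadditive _ _ _ (P \x Q)%E).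
(* Asking for mass at least 1, rather than for a full section, makes [M] measurable. *)
pose M := [set w | (1 <= Q (xsection U w))%E].
have mM : measurable M.
  rewrite -[M]setTI; apply: (@emeasurable_fun_c_infty _ _ _ _ (Q \o xsection U)) => //.
  exact: measurable_fun_xsection.
have FM : F `<=` M.
  move=> w Fw; rewrite /M /= (_ : xsection U w = setT) ?probability_setT//.
  by apply/seteqP; split=> // y _; rewrite /xsection /= inE; exact: (FC (w, y)).
apply: le_trans (le_mu_ext P FM) _; rewrite measurable_mu_extE//.
rewrite -[X in (P X <= _)%E]setIT -integral_indic// /product_measure1.
apply: ge0_le_integral => //=.
- exact/measurable_EFinP/measurable_indic.
- exact: measurable_fun_xsection.
- move=> w _; rewrite indicE.
  case: (boolP (w \in M)) => [|_] /=; last by rewrite measure_ge0.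
  by rewrite inE.
Qed.

(** On a space that lacks the variable [k], one is obtained by taking a product
   with its law. *)
Lemma prob_le_drop1 (J : eqType) (D : pred J) (k : J) (law : J -> option realprob)
    (E : (J -> R) -> Prop) r :
  law k -> (forall eta x, E eta -> E (upd eta k x)) ->
  prob_le [pred j | (j == k) || D j] law E r -> prob_le D law E r.
Proof.
case lk: (law k) => [mu|//] _ Ek H.
case: (boolP (D k)) => Dk.
  by apply: prob_le_mono H => // j /orP[/eqP ->|].
move=> d T P X Xind Xlaw.
(* The second coordinate takes the place of [X k], whose law is unconstrained because [k] is outside
   [D]. *)
pose X' j (wy : T * measurableTypeR R) : measurableTypeR R :=
  if j == k then wy.2 else X j wy.1.
have mX' j : measurable_fun [set: T * measurableTypeR R] (X' j).
  rewrite /X'; case: (j == k); first exact: measurable_snd.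
  by apply: (measurableT_comp (measurable_funPT (X j))); exact: measurable_fst.
pose Y j : {RV (P \x mu)%E >-> measurableTypeR R} :=
  mfun_Sub (mem_set (mX' j)).
have XE j (A : set R) : j != k ->
    Y j @^-1` A = (X j @^-1` A) `*` setT.
  by move=> jk; apply/seteqP; split=> -[w y] /=; rewrite /X' (negbTE jk) => // -[].
have kE (A : set R) : Y k @^-1` A = setT `*` A.
  by apply/seteqP; split=> -[w y] /=; rewrite /X' eqxx => // -[].
have YkE (A : set (measurableTypeR R)) : measurable A -> (P \x mu)%E (Y k @^-1` A) = mu A.
  move=> mA; rewrite kE; apply: eq_trans (product_measure1E P mu measurableT mA) _.
  by rewrite /= probability_setT mul1e.
have YE j (A : set (measurableTypeR R)) : j != k -> measurable A ->
    (P \x mu)%E (Y j @^-1` A) = P (X j @^-1` A).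
  move=> jk mA; rewrite XE//.
  apply: eq_trans (product_measure1E P mu (measurable_funPTI (X j) mA) measurableT) _.
  by rewrite /= probability_setT mule1.
have Yind : mutually_independent [pred j | (j == k) || D j] Y.
  move=> s A us /allP sD mA.
  (* The event is a rectangle: variables other than [k] constrain the first factor and [k], if
     listed, the second. *)
  have -> : \bigcap_(j in [set` s]) Y j @^-1` A j =
      (\bigcap_(j in [set` [seq j <- s | j != k]]) X j @^-1` A j) `*`
      (if k \in s then A k else setT).
    have Xwy j w y : X' j (w, y) = if j == k then y else X j w by [].
    apply/seteqP; split=> -[w y] HA; last first.
      move=> j /= js; rewrite Xwy; have [jk|jk] := eqVneq j k.
        by rewrite jk in js *; move: HA => [_]; rewrite /= js.
      by apply: HA.1 => /=; rewrite mem_filter jk.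
    split=> [j /=|/=].
      by rewrite mem_filter => /andP[jk /HA]; rewrite /= Xwy (negbTE jk).
    by case: ifP => // /HA; rewrite /= Xwy eqxx.
  have mI : measurable (\bigcap_(j in [set` [seq j <- s | j != k]]) X j @^-1` A j).
    elim: [seq j <- s | j != k] => [|i l IH].
      by rewrite (_ : \bigcap_(j in _) _ = setT)//; apply/seteqP; split.
    rewrite (_ : \bigcap_(j in _) _ =
        X i @^-1` A i `&` \bigcap_(j in [set` l]) X j @^-1` A j).
      by apply: measurableI => //; exact: measurable_funPTI.
    apply/seteqP; split=> w wA.
      split=> [|j jl]; first by apply: wA; rewrite /= mem_head.
      by apply: wA; rewrite /= inE [_ \in l]jl orbT.
    by move=> j /=; rewrite inE => /orP[/eqP ->|jl]; [exact: wA.1|exact: wA.2].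
  pose Ak : set (measurableTypeR R) := if k \in s then A k else setT.
  have mk : measurable Ak.
    by rewrite /Ak; case: (k \in s); [exact: mA|exact: measurableT].
  apply: eq_trans (product_measure1E P mu mI mk) _ => /=; rewrite /Ak.
  rewrite Xind ?filter_uniq//; last first.
    apply/allP => j; rewrite mem_filter => /andP[jk /sD].
    by rewrite /= (negbTE jk).
  rewrite [RHS](bigID (pred1 k)) /= muleC big_filter; congr (_ * _)%E; last first.
    by apply: eq_bigr => j jk; rewrite YE.
  rewrite -big_filter; case: ifPn => ks.
    by rewrite filter_pred1_uniq// big_seq1 YkE.
  rewrite probability_setT (_ : [seq i <- s | i == k] = [::]) ?big_nil//.
  apply/eqP; rewrite -[_ == _]negbK -has_filter; apply/hasPn => j js.
  by apply: contraNN ks => /eqP <-.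
apply: le_trans (H _ _ _ Y Yind _); last first.
  move=> j nu /orP[/eqP ->|Dj] lj A mA.
    by move: lj; rewrite lk => -[<-]; exact: YkE.
  have jk : j != k by apply: contraNN Dk => /eqP <-.
  by rewrite -(Xlaw j nu)//; exact: YE.
apply: le_trans (mu_ext_cylinder P mu _) _.
(* [E] survives resetting variable [k] to [y], so the cylinder over the old event lies in the new
   event. *)
apply: le_mu_ext => -[w y] /= [/(Ek _ y) + _].
by congr E; apply: funext => j; rewrite /= /upd /X'; case: eqP.
Qed.

Lemma prob_le_drop (J : eqType) (D : pred J) (ks : seq J)
    (law : J -> option realprob) (E : (J -> R) -> Prop) r :
  all law ks -> (forall k eta x, k \in ks -> E eta -> E (upd eta k x)) ->
  prob_le [pred j | (j \in ks) || D j] law E r -> prob_le D law E r.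
Proof.
elim: ks => [|k ks IH] /=; first by move=> _ _; exact: prob_le_mono.
move=> /andP[lk lks] Ek H; apply: IH => //.
  by move=> j eta x jks; apply: Ek; rewrite inE jks orbT.
apply: (@prob_le_drop1 _ _ k) => //.
  by move=> eta x; apply: Ek; rewrite mem_head.
apply: prob_le_mono H => // j.
by rewrite !inE /= orbA.
Qed.

(** A family indexed by [J'] is pulled back along the partial map [k], with the constant 0 where [k]
    is undefined. The left inverse [g] makes [k] injective on [D], so no variable is repeated and
    independence survives. *)
Lemma prob_le_reindex (J J' : eqType) (D : pred J) (D' : pred J')
    (k : J -> option J') (g : J' -> J)
    (law : J -> option realprob) (law' : J' -> option realprob)
    (E : (J -> R) -> Prop) (E' : (J' -> R) -> Prop) r :
  (forall j, D j -> exists j', [/\ k j = Some j', g j' = j, D' j' &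
     law j = law' j']) ->
  (forall eta, E' eta -> E (fun j => oapp eta 0 (k j))) ->
  prob_le D law E r -> prob_le D' law' E' r.
Proof.
move=> Dk E'E H d T P X Xind Xlaw.
pose zero : {RV P >-> measurableTypeR R} := cst (0 : measurableTypeR R).
pose Y j : {RV P >-> measurableTypeR R} := oapp X zero (k j).
apply: le_trans (H d T P Y _ _).
- apply: le_mu_ext => w /E'E /=; congr E; apply: funext => j.
  by rewrite /Y; case: (k j).
- move=> s A us /allP sD mA.
  have sE : s = map g (pmap k s).
    elim: s sD {us} => //= j s IH sD.
    have [j' [-> /= -> _ _]] := Dk j (sD _ (mem_head _ _)).
    by rewrite -IH// => i si; apply: sD; rewrite inE si orbT.
  have kg : {in pmap k s, forall j, k (g j) = Some j}.
    move=> j; rewrite mem_pmap => /mapP[i si /esym kij].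
    by have [j' [+ gj _ _]] := Dk i (sD _ si); rewrite kij => -[jj]; rewrite jj gj kij jj.
  rewrite [X in P X = _](_ : _ =
      \bigcap_(j in [set` pmap k s]) X j @^-1` A (g j)); last first.
    rewrite {1}sE; apply/seteqP; split=> w wA.
      by move=> j /= js; move: (wA (g j)); rewrite /= map_f// /Y kg//; apply.
    by move=> _ /= /mapP[j js ->]; move: (wA j js); rewrite /Y /= kg.
  rewrite [in RHS]sE big_map.
  rewrite Xind//.
  + by apply: eq_big_seq => j js; rewrite /Y kg.
  + by move: us; rewrite {1}sE; exact: map_uniq.
  + apply/allP => j; rewrite mem_pmap => /mapP[i si /esym kij].
    by have [j' [+ _ Dj' _]] := Dk i (sD _ si); rewrite kij => -[->].
- move=> j mu Dj lj A mA; have [j' [kj _ Dj' ll']] := Dk j Dj.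
  by rewrite /Y kj /=; apply: Xlaw => //; rewrite -ll'.
Qed.

End ProbLe.

Lemma prob_le_impossible (R : realType) (J : eqType) (D : pred J)
    (law : J -> option (probability (measurableTypeR R) R))
    (E : (J -> R) -> Prop) r :
  0 <= r -> (forall eta, ~ E eta) -> prob_le D law E r.
Proof.
move=> r0 E0 d T P X _ _.
rewrite (_ : [set w | _] = set0); last by apply/seteqP; split=> w // /E0.
by rewrite mu_ext0 // lee_fin.
Qed.

(** Meant for defined noise sums: their only function symbols are constants, so [pf] shuts out the
    possibly non-measurable interpretations of unknowns. *)
Lemma measurable_eval (R : realType) (F : Type) (ar : F -> nat) (V : Type)
    (I : interp R ar) (pf : pred F) (pv : pred V) d (T : measurableType d)
    (v : V -> T -> R) (t : term R ar V) :
  (forall f, pf f -> exists r, forall a, I f a = r) ->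
  (forall x, pv x -> measurable_fun [set: T] (v x)) ->
  term_over pf pv t ->
  measurable_fun [set: T] (fun w => eval I (fun x => v x w) t).
Proof.
move=> Icst mv; elim: t => //=.
- move=> f a _ /andP[/Icst[r fr] _].
  by under eq_fun do rewrite fr; exact: measurable_cst.
- move=> t IH /IH mt; apply: (measurableT_comp _ mt); exact: normr_measurable.
- by move=> t IHt u IHu /andP[/IHt mt /IHu mu]; exact: measurable_funD.
- by move=> t IHt u IHu /andP[/IHt mt /IHu mu]; exact: measurable_funM.
- by move=> t IHt u IHu /andP[/IHt mt /IHu mu]; exact: measurable_minr.
- by move=> t IHt u IHu /andP[/IHt mt /IHu mu]; exact: measurable_maxr.
Qed.

(** * Soundness of inference assignments *)

Section Partial.
Variables (R : realType) (F : Type) (ar : F -> nat).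
Implicit Types (I : pinterp R ar).

Lemma peval_rename (V W : Type) I (pf : pred F) (pv : pred V) (h : V -> W)
    (v : pval R W) (v' : pval R V) (t : term R ar V) :
  (forall x, pv x -> v (h x) = v' x) -> term_over pf pv t ->
  peval I v (trename h t) = peval I v' t.
Proof.
move=> vv' tO; rewrite /peval.
have -> : tdefined I v (trename h t) = tdefined I v' t.
  rewrite /tdefined; elim: t tO => //=.
  - by move=> x /vv' ->.
  - move=> f a IH /andP[_ /forallP aO]; congr (_ && _).
    by apply: eq_forallb => i; exact: IH.
  - by move=> t IHt u IHu /andP[/IHt -> /IHu ->].
  - by move=> t IHt u IHu /andP[/IHt -> /IHu ->].
  - by move=> t IHt u IHu /andP[/IHt -> /IHu ->].
  - by move=> t IHt u IHu /andP[/IHt -> /IHu ->].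
case: ifP => // _; congr Some; rewrite eval_rename.
apply: (@eval_over _ _ _ _ _ _ predT pv) => //.
  by move=> x /vv' /=; rewrite /total_val => ->.
by elim: t tO => //= [f a IH /andP[_ /forallP aO]|t IHt u IHu /andP[/IHt -> /IHu ->]
  |t IHt u IHu /andP[/IHt -> /IHu ->]|t IHt u IHu /andP[/IHt -> /IHu ->]
  |t IHt u IHu /andP[/IHt -> /IHu ->]] //; apply/forallP => i; exact: IH.
Qed.

Lemma dist_law_rename (V W : Type) I (pf : pred F) (pv : pred V) (h : V -> W)
    (v : pval R W) (v' : pval R V) (d : dist R ar V) :
  (forall x, pv x -> v (h x) = v' x) -> dist_over pf pv d ->
  dist_law I v (drename h d) = dist_law I v' d.
Proof.
move=> vv'; case: d => [t u|t u|t] /=; last by move=> tO; rewrite (peval_rename _ vv' tO).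
  by move=> /andP[tO uO]; rewrite (peval_rename _ vv' tO) (peval_rename _ vv' uO).
by move=> /andP[tO uO]; rewrite (peval_rename _ vv' tO) (peval_rename _ vv' uO).
Qed.

Lemma trename_id (V : Type) (t : term R ar V) : trename id t = t.
Proof.
elim: t => //=.
- by move=> f a IH; congr TApp; apply: functional_extensionality_dep => i.
- by move=> t ->.
- by move=> t -> u ->.
- by move=> t -> u ->.
- by move=> t -> u ->.
- by move=> t -> u ->.
Qed.

Lemma rename_id_qf (V : Type) (P : formula R ar V) : qf P -> rename id P = P.
Proof.
rewrite /qf; elim: P => //=.
- by move=> c t u _; rewrite !trename_id.
- by move=> P IH /IH ->.
- by move=> P IHP Q IHQ /andP[/IHP -> /IHQ ->].
- by move=> P IHP Q IHQ /andP[/IHP -> /IHQ ->].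
- by move=> P IHP Q IHQ /andP[/IHP -> /IHQ ->].
- by move=> P IHP Q IHQ /andP[/IHP -> /IHQ ->].
Qed.

End Partial.

(** * List membership, weighted sums and indexed unions *)

Lemma List_In_cat (A : Type) (s t : seq A) x :
  List.In x (s ++ t) -> List.In x s \/ List.In x t.
Proof.
elim: s => [|y s IH] /=; first by right.
by case=> [->|/IH[]]; [left; left|left; right|right].
Qed.

Lemma List_In_all (A : Type) (p : pred A) (s : seq A) x : all p s -> List.In x s -> p x.
Proof. by elim: s => //= y s IH /andP[py /IH ps] [<-|]. Qed.

Lemma List_In_pmap (A : eqType) (B : Type) (f : A -> option B) (s : seq A) y :
  List.In y (pmap f s) <-> exists2 x, x \in s & f x = Some y.
Proof.
elim: s => [|a s IH] /=; first by split=> // -[].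
case fa: (f a) => [b|] /=; rewrite IH; split.
- case=> [<-|[x xs fx]]; first by exists a; rewrite ?mem_head.
  by exists x; rewrite // inE xs orbT.
- case=> x; rewrite inE => /orP[/eqP ->|xs fx]; last by right; exists x.
  by rewrite fa => -[->]; left.
- by case=> x xs fx; exists x; rewrite // inE xs orbT.
- case=> x; rewrite inE => /orP[/eqP ->|xs fx]; last by exists x.
  by rewrite fa.
Qed.

(** Otherwise all terms [l i * (a i - m)] would be positive, yet they sum to 0 because the weights
    sum to 1. *)
Lemma weighted_mean_ge (R : realFieldType) (A : eqType) (D : seq A) (l a : A -> R) :
  {in D, forall i, 0 < l i} -> \sum_(i <- D) l i = 1 ->
  exists2 i, i \in D & a i <= \sum_(j <- D) l j * a j.
Proof.
move=> l0 l1; set m := \sum_(j <- D) _; apply: contrapT => H.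
have am i : i \in D -> 0 < l i * (a i - m).
  move=> iD; apply: mulr_gt0; first exact: l0.
  by rewrite subr_gt0 ltNge; apply/negP => ai; apply: H; exists i.
have : \sum_(i <- D) l i * (a i - m) = 0.
  under eq_bigr do rewrite mulrBr.
  by rewrite sumrB -mulr_suml l1 mul1r subrr.
rewrite big_seq => /eqP; rewrite psumr_eq0; last by move=> i /am/ltW.
move=> /allP D0; have [i iD] : exists i, i \in D.
  case: (D) l1 => [|i D' _]; last by exists i; rewrite mem_head.
  by rewrite big_nil => /esym/eqP; rewrite oner_eq0.
by move: (D0 i iD); rewrite iD /= => /eqP di; have := am i iD; rewrite di ltxx.
Qed.

Section WeightedSum.
Variables (R : realType) (S : signature).
Local Notation iterm := (term R (@sym_arity S) (ivar S)).
Implicit Types (I : interp R (@sym_arity S)).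

Lemma eval_weighted_sum I (v : ivar S -> R) (D : seq (R * iterm)) :
  eval I v (weighted_sum D) = \sum_(lt <- D) lt.1 * eval I v lt.2.
Proof. by elim: D => [|lt D IH] /=; rewrite ?big_nil// big_cons IH. Qed.

Lemma tvars_weighted_sum (A : eqType) (D : seq A) (l : A -> R) (t : A -> iterm) a :
  a \in D ->
  {subset tvars (t a) <= tvars (weighted_sum [seq (l i, t i) | i <- D])}.
Proof.
elim: D => //= b D IH; rewrite inE => /orP[/eqP ->|/IH sub] x xt.
  by rewrite mem_cat xt.
by rewrite mem_cat sub ?orbT.
Qed.

Lemma tvars_weighted_sum_sub (A : Type) (D : seq A) (l : A -> R) (t : A -> iterm)
    (p : pred (ivar S)) :
  (forall a, {in tvars (t a), forall x, p x}) ->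
  {in tvars (weighted_sum [seq (l i, t i) | i <- D]), forall x, p x}.
Proof. by move=> tp; elim: D => //= b D IH x; rewrite mem_cat => /orP[/tp|/IH]. Qed.

Lemma instantiate_in (N : NoiseVar S -> dist R (@sym_arity S) (base_var S))
    (s : seq (Param S * iexpr R S)) (a : actions s) t :
  List.In t (instantiate N a) ->
  exists p e (a1 : action e), List.In (p, e) s /\ List.In t (instantiate1 N p a1).
Proof.
elim: s a => [a []|[p e] s IH [a1 a] /= ta].
case: (List_In_cat ta) => {}ta.
  by exists p, e, a1; split=> //; left.
have [q [f [b [qs tb]]]] := IH a ta.
by exists q, f, b; split=> //; right.
Qed.

End WeightedSum.

(** Each [index_val i] is undefined at indices other than [i], so no other step can mask the
    valuation of step [k]. *)
Lemma foldr_index_val (R : realType) (S : signature) (f : nat -> pval R (base_var S))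
    (v0 : pval R (ivar S)) (l : seq nat) y k :
  v0 (Idx y (Num k)) = None ->
  foldr (@vunion R (ivar S)) v0 [seq index_val i (f i) | i <- l] (Idx y (Num k))
  = if k \in l then f k y else None.
Proof.
move=> v0k; elim: l => //= i l IH.
rewrite {1}/vunion IH /= inE; case: eqVneq => [->|_] //=.
by case: (f i y) => //; case: ifP.
Qed.

Lemma foldr_index_val_other (R : realType) (S : signature)
    (f : nat -> pval R (base_var S)) (v0 : pval R (ivar S)) (l : seq nat) x :
  (forall y k, x <> Idx y (Num k)) ->
  foldr (@vunion R (ivar S)) v0 [seq index_val i (f i) | i <- l] x = v0 x.
Proof.
move=> xN; elim: l => //= i l IH; rewrite {1}/vunion IH.
by case: x xN {IH} => [y|y [k|k]] //= /(_ y k).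
Qed.

(** * Partial knowledge and actual values along a fixed history *)

Section Soundness.
Variables (R : realType) (S : signature) (sp : shield_spec R S).
Variable impl : cdf_impl R (@sym_arity S) (ivar S).
Hypothesis impl_correct : cdf_impl_correct impl.
Hypothesis obl : valid (obligation sp).
Variables (c : Const S -> R) (u : forall f : Unknown S, ('I_(arity f) -> R) -> R).
Variables (n : nat) (s : nat -> StateVar S -> R) (z : nat -> {set ObsVar S}).
Variable b : nat -> pval R (Param S).
Hypothesis n0 : (0 < n)%N.
Hypothesis hyp : forall i, (1 <= i <= n)%N ->
  (forall q, global_param (Bound sp) q -> Pa q \in FV (Inv sp) -> isSome (b i q)) /\
  psat (spec_interp c u) (vunion (state_val (s i)) (param_val (b i)))
    (FAnd (bigand (Assum sp)) (FAnd (Inv sp) (Bounds sp (b i)))).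

Local Notation I := (spec_interp c u).
Local Notation cI := (const_interp (S := S) c).
Local Notation iterm := (term R (@sym_arity S) (ivar S)).
Local Notation iformula := (formula R (@sym_arity S) (ivar S)).

Definition base_val (k : nat) : base_var S -> R :=
  total_val (vunion (state_val (s k)) (param_val (b k))).

Definition step_obs (eta : nat * NoiseVar S -> R) (k : nat) :=
  obs_val sp I (s k) (fun y => eta (k, y)) (z k).

(** This is the valuation [v] in the definition of [sound]. *)
Definition known (eta : nat * NoiseVar S -> R) : pval R (ivar S) :=
  foldr (@vunion R (ivar S))
    (plain_val (vunion (state_val (s n)) (param_val (b n))))
    [seq index_val i (vunion (vunion (state_val (s i)) (param_val (b i)))
                             (step_obs eta i)) | i <- iota 1 n].

Definition step_val (eta : nat * NoiseVar S -> R) (k : nat) : base_var S -> R :=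
  fun y => match y with
  | No y => eta (k, y)
  | Ob w => eval I (total_val (vunion (state_val (s k))
                                      (noise_val (fun y => eta (k, y))))) (Obs sp w)
  | _ => base_val k y
  end.

(** The 0 at symbolic indices is a placeholder: [known] is undefined there, so no successful
    evaluation reads it. *)
Definition actual (eta : nat * NoiseVar S -> R) : ivar S -> R :=
  fun x => match x with
  | Plain y => base_val n y
  | Idx y (Num k) => step_val eta k y
  | Idx _ (Sym _) => 0
  end.

Lemma known_Plain eta y :
  known eta (Plain y) = vunion (state_val (s n)) (param_val (b n)) y.
Proof. by rewrite /known foldr_index_val_other. Qed.

Lemma known_Sym eta y k : known eta (Idx y (Sym k)) = None.
Proof. by rewrite /known foldr_index_val_other. Qed.

Lemma known_Num eta y k :
  known eta (Idx y (Num k)) = if (1 <= k <= n)%N then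
    vunion (vunion (state_val (s k)) (param_val (b k))) (step_obs eta k) y else None.
Proof. by rewrite /known foldr_index_val// mem_iota add1n ltnS. Qed.

Lemma known_actual eta x r : known eta x = Some r -> actual eta x = r.
Proof.
case: x => [y|y [k|k]]; last by rewrite known_Sym.
  by rewrite known_Plain /= /base_val /total_val => ->.
rewrite known_Num; case: ifP => // _ /=.
case: y => [y|p|y|w|m] //=; rewrite /vunion /base_val /total_val //=.
- by move=> [].
- by rewrite /vunion /=; case: (b k p) => // ? [].
- by case: ifP => // _ [].
Qed.

(** Noise reaches the inference only through observations; hence the known part of a noise sum is
    the same for all outcomes. *)
Lemma known_noise eta eta' x :
  ~~ is_obs (ivar_base x) -> known eta x = known eta' x.
Proof.
case: x => [y|y [k|k]]; rewrite ?known_Sym ?known_Plain ?known_Num//.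
by case: ifP => // _; case: y.
Qed.

Lemma eq_known eta eta' :
  (forall k y, (1 <= k <= n)%N -> eta (k, y) = eta' (k, y)) -> known eta = known eta'.
Proof.
move=> ee; rewrite /known; congr foldr; apply/eq_in_map => i.
rewrite mem_iota add1n ltnS => /ee ei; congr (index_val i (vunion _ _)).
rewrite /step_obs (_ : (fun y => eta (i, y)) = (fun y => eta' (i, y)))//.
exact: funext.
Qed.

Lemma n_in : (1 <= n <= n)%N. Proof. by rewrite n0 leqnn. Qed.

(** The assumptions are closed, so their truth at step [n], which exists since [0 < n], carries over
    to every valuation. *)
Lemma sat_Assum (v : base_var S -> R) : sat I (bigand (Assum sp)) v.
Proof.
have [_ [_ /= [As _]]] := hyp n_in.
apply: (sat_agree As) => x /FV_bigand[P PA].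
by rewrite (Assum_closed PA).
Qed.

Lemma sat_Inv k (v : base_var S -> R) : (1 <= k <= n)%N ->
  (forall y, v (St y) = s k y) ->
  (forall p, isSome (b k p) -> v (Pa p) = odflt 0 (b k p)) -> sat I (Inv sp) v.
Proof.
move=> kn vs vb; have [gl [_ /= [_ [Iv _]]]] := hyp kn.
apply: (sat_agree Iv) => x xI.
have [|[p xp gp]] := Inv_vars xI; first by case: x {xI} => //= y _; rewrite vs.
by rewrite xp in xI *; rewrite vb//; exact: gl.
Qed.

Lemma sat_Bound k p r (v : base_var S -> R) : (1 <= k <= n)%N ->
  b k p = Some r -> (forall y, v (St y) = s k y) -> v (Pa p) = r ->
  sat I (Bound sp p) v.
Proof.
move=> kn bp vs vp; have [_ [_ /= [_ [_ /sat_bigand Bs]]]] := hyp kn.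
have /sat_subst /= : sat I (subst (Pa p) (TLit r) (Bound sp p)) (base_val k).
  apply: Bs; apply/List_In_pmap; exists p; first by rewrite mem_enum.
  by rewrite bp.
move/sat_agree; apply => x /Bound_vars[->|]; first by rewrite /upd eqxx.
by case: x => //= y _; rewrite vs.
Qed.

(** [sigma] instantiates symbolic indices, acting on indices alone through [tau]. A known variable
    belongs to a step in 1..n (step [n] if plain), where [hyp] applies; a noise variable has a
    trivial condition. *)
Lemma sat_var_cond eta (sigma : ivar S -> ivar S) (tau : index -> index) x :
  (forall y, sigma (Plain y) = Plain y) ->
  (forall y i, sigma (Idx y i) = Idx y (tau i)) ->
  isSome (known eta (sigma x)) || is_noise (ivar_base x) ->
  sat I (var_cond sp x) (actual eta \o sigma).
Proof.
move=> sP sI; case: x => [y|y i] /=.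
  rewrite sP known_Plain => yk; apply/sat_rename; first by move=> ? ? [].
  case: y yk => [y|p|y|w|m] //=.
  - by move=> _; apply: (sat_Inv n_in) => [y'|p bp]; rewrite /= sP//=.
  - rewrite orbF /vunion /=; case bp: (b n p) => [r|] // _.
    apply: (sat_Bound n_in bp) => [y'|]; rewrite /= sP//=.
    by rewrite /base_val /total_val /vunion /= bp.
rewrite sI; case ti: (tau i) => [k|k]; last first.
  by rewrite known_Sym /=; case: y.
(* The renaming is injective although it leaves non-free variables plain, and on the free ones
   [sigma] leads to step [k]. *)
have index_formulaE (Q : formula R (@sym_arity S) (base_var S)) :
    sat I Q (step_val eta k) -> sat I (index_formula i Q) (actual eta \o sigma).
  move=> Qk; apply/sat_rename.
    by move=> y1 y2; case: ifP => _; case: ifP => _ // [].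
  by apply: (sat_agree Qk) => y' yQ /=; rewrite yQ sI ti.
rewrite known_Num; case: ifP => kn; last by case: y.
case: y => [y|p|y|w|m] yk; apply: index_formulaE => //=.
- exact: (sat_Inv kn).
- move: yk; rewrite orbF /vunion /=; case bp: (b k p) => [r|] // _.
  apply: (sat_Bound kn bp) => //=.
  by rewrite /base_val /total_val /vunion /= bp.
- apply: (@eval_over _ _ _ _ _ _ predT _ _ _ _ _ _ (Obs_over sp w)) => //.
  by case.
Qed.

(** * Values satisfying a bound at the final state *)

Definition bound_ok (p : Param S) (r : R) : Prop :=
  sat I (Bound sp p) (upd (base_val n) (Pa p) r).

(** [Bound_upper] is read with [Aux 0] set to [r] and [Aux 1] to [r']; by [Bound_vars] these are not
    free in the bound, which therefore ignores the extra updates. *)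
Lemma bound_ok_le p r r' : r <= r' -> bound_ok p r -> bound_ok p r'.
Proof.
move=> rr' okr.
have B := @Bound_upper R S sp p I (base_val n) r r' rr'.
have E (q : R) (x : base_var S) : x = Aux 0 \/ x = Aux 1 ->
  sat I (subst (Pa p) (TVar x) (Bound sp p))
    (upd (upd (base_val n) (Aux 0) r) (Aux 1) r') <->
  bound_ok p (upd (upd (base_val n) (Aux 0) r) (Aux 1) r' x).
  move=> xA; rewrite sat_subst /=; apply: sat_coincidence => y /Bound_vars[->|].
    by rewrite /upd !eqxx.
  by case: y.
by apply/(E r' (Aux 1)); [right|apply: B; apply/(E r (Aux 0)); [left|]].
Qed.

(** Only the bound of [p] is new. Those of the other parameters, and that of [p] when [r] is [None],
    are inherited from step [n]. *)
Lemma psat_Bounds p r : (forall q, r = Some q -> bound_ok p q) ->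
  psat I (state_val (s n)) (Bounds sp (pupd (b n) p r)).
Proof.
move=> okr; split.
  apply/allP => x /FV_bigand[P /List_In_pmap[q _]].
  case: (pupd _ _ _ q) => //= r' [<-] /FV_subst_lit /andP[/Bound_vars[->|]].
    by rewrite eqxx.
  by case: x.
apply/sat_bigand => P /List_In_pmap[q _].
have agree (v : base_var S -> R) r' : (forall y, v (St y) = s n y) ->
    sat I (Bound sp q) (upd (total_val (state_val (s n))) (Pa q) r') <->
    sat I (Bound sp q) (upd v (Pa q) r').
  move=> vs; apply: sat_coincidence => x /Bound_vars[->|]; first by rewrite /upd eqxx.
  by case: x => //= y _; rewrite /upd /= vs.
case bq: (pupd _ _ _ q) => [r'|] //= [<-]; apply/sat_subst => /=.
apply/(agree (base_val n)) => //.
move: bq; rewrite /pupd; case: eqVneq => [->|_].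
  case: r okr => [q'|] okr; first by move=> [<-]; exact: okr.
  by move=> bp; apply: (sat_Bound n_in bp) => //; rewrite /upd eqxx.
by move=> bp; apply: (sat_Bound n_in bp) => //; rewrite /upd eqxx.
Qed.

(** [sat_Assum] and [sat_var_cond] discharge the premises. Since [sigma] fixes plain variables, the
    conclusion is about the final state. *)
Lemma bound_of_obligation eta (sigma : ivar S -> ivar S) (tau : index -> index)
    (xs : seq (ivar S)) p (t : iterm) (G : iformula) :
  (forall y, sigma (Plain y) = Plain y) ->
  (forall y i, sigma (Idx y i) = Idx y (tau i)) ->
  sat I (FImp (FAnd (rename Plain (bigand (Assum sp))) (bigand (map (var_cond sp) xs)))
     (FImp G (subst (Plain (Pa p)) t (rename Plain (Bound sp p)))))
    (actual eta \o sigma) ->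
  {in xs, forall x, isSome (known eta (sigma x)) || is_noise (ivar_base x)} ->
  sat I G (actual eta \o sigma) ->
  bound_ok p (eval I (actual eta \o sigma) t).
Proof.
move=> sP sI /= O xk sG.
have PI : injective (@Plain S) by move=> ? ? [].
have /sat_subst/(sat_rename _ _ _ PI) : sat I
    (subst (Plain (Pa p)) t (rename Plain (Bound sp p))) (actual eta \o sigma).
  apply: O sG; split; first by apply/sat_rename => //; exact: sat_Assum.
  apply/sat_bigand => P /List_In_map[x xxs <-].
  apply: (sat_var_cond sP sI); apply: xk.
  by elim: xs xxs => //= y xs IH [->|/IH]; rewrite inE ?eqxx// => ->; rewrite orbT.
rewrite upd_comp// (_ : (actual eta \o sigma) \o Plain = base_val n)//.
by apply: funext => y /=; rewrite sP.
Qed.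

Lemma obligation_in p e : List.In (p, e) (Infer sp) ->
  forall v, sat I (obligation1 sp p e) v.
Proof.
move=> pe v; have /sat_bigand := obl I v; apply.
by apply/List_In_map; exists (p, e).
Qed.

Lemma total_const_interp f : isSome ((cI : pinterp R (@sym_arity S)) f) ->
  (total_interp cI : interp R (@sym_arity S)) f = (I : interp R (@sym_arity S)) f.
Proof. by case: f. Qed.

(** A successful evaluation reads only known variables and constants, on which [known] and [cI]
    agree with [actual] and [I]. *)
Lemma peval_known eta (sigma : ivar S -> ivar S) (t : iterm) r :
  peval cI (known eta) (trename sigma t) = Some r ->
  eval I (actual eta \o sigma) t = r /\
  {in tvars t, forall x, isSome (known eta (sigma x))}.
Proof.
rewrite /peval; case: ifP => // tD [<-]; split; last first.
  move=> x xt; apply: (term_overP tD).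
  by rewrite tvars_rename map_f.
rewrite -eval_rename; apply/esym; apply: (eval_over _ _ tD).
  exact: total_const_interp.
by move=> x; rewrite /total_val; case kx: (known eta x) => [r'|] // _;
  rewrite (known_actual kx).
Qed.

Lemma pholds_known eta (sigma : ivar S -> ivar S) (G : iformula) : qf G ->
  pholds cI (known eta) (rename sigma G) ->
  sat I G (actual eta \o sigma) /\
  {in FV G, forall x, isSome (known eta (sigma x))}.
Proof.
move=> qG /andP[GD /asboolP sG]; split; last first.
  by move=> x xG; apply: (qf_overP GD); rewrite FV_rename_qf// map_f.
apply/sat_rename_qf => //; apply: (proj1 (sat_qf_over _ _ GD) sG).
  exact: total_const_interp.
by move=> x; rewrite /total_val; case kx: (known eta x) => [r'|] // _;
  rewrite (known_actual kx).
Qed.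

(** With [sigma] the identity this serves direct assignments, otherwise one entry of a [Best] list;
    it holds for every noise outcome. *)
Lemma sound_deterministic eta (sigma : ivar S -> ivar S) (tau : index -> index)
    p (t : iterm) (G : iformula) :
  (forall y, sigma (Plain y) = Plain y) ->
  (forall y i, sigma (Idx y i) = Idx y (tau i)) -> qf G ->
  (forall v, sat I (FImp (FAnd (rename Plain (bigand (Assum sp)))
                    (bigand (map (var_cond sp) (tvars t ++ FV G))))
     (FImp G (subst (Plain (Pa p)) t (rename Plain (Bound sp p))))) v) ->
  psat I (state_val (s n)) (Bounds sp (pupd (b n) p
    (eval_sbi impl cI (known eta) (SWhen (STerm (trename sigma t)) (rename sigma G))))).
Proof.
move=> sP sI qG O; apply: psat_Bounds => q /=.
case: ifP => // /(pholds_known qG)[sG Gk] /peval_known[<- tk].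
apply: (bound_of_obligation sP sI (O _)) => // x.
by rewrite mem_cat => /orP[/tk|/Gk] ->.
Qed.

(** * Aggregates *)

Lemma noise_distsP (N : NoiseVar S -> dist R (@sym_arity S) (base_var S))
    (t : iterm) x :
  x \in unzip1 (noise_dists N t) ->
  exists y l, x = Idx (No y) (Num l) /\
    [seq yd.2 | yd <- noise_dists N t & yd.1 == x] =
      [:: drename (fun w => Idx w (Num l)) (N y)].
Proof.
rewrite /noise_dists; move: (undup_uniq (tvars t)).
elim: (undup (tvars t)) => //= x' l IH /andP[x'l ul].
have skip (r : seq (ivar S)) : x' \notin r ->
    [seq yd <- pmap (fun x => if x is Idx (No y) (Num l) then
       Some (x, drename (fun z => Idx z (Num l)) (N y)) else None) r
     | yd.1 == x'] = [::].
  elim: r => //= a r IHr; rewrite inE negb_or eq_sym => /andP[ax' /IHr].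
  by case: a ax' => [y|[y|p|y|w|m] [k|k]] //= ax'; rewrite (negbTE ax').
case: x' x'l skip => [y|[y|p|y|w|m] [k|k]] x'l skip //=; try exact: IH.
rewrite inE => /orP[/eqP ->|xl].
  by exists y, k; rewrite eqxx /= skip.
case: eqVneq => [xE|_]; last exact: IH.
by exists y, k; split; [rewrite xE|rewrite -xE /= skip].
Qed.

(** Distribution expressions read only state variables, so the law does not vary with the outcome.
    Outside 1..n the valuation is empty, and a law exists only for expressions without variables. *)
Lemma cdf_law_known (ds := fun u2 => noise_dists (Noise sp) u2) (u2 : iterm) eta y l :
  Idx (No y) (Num l) \in unzip1 (ds u2) ->
  cdf_law cI (known eta) (ds u2) (Idx (No y) (Num l)) =
  dist_law cI (if (1 <= l <= n)%N then state_val (s l) else fun=> None) (Noise sp y).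
Proof.
move=> /noise_distsP[y' [l' [[<- <-] dE]]]; rewrite /cdf_law dE.
apply: (dist_law_rename _ _ (Noise_over sp y)) => x xs.
by rewrite known_Num; case: ifP => // _; case: x xs.
Qed.

Lemma sound_aggregate p ix (t1 t2 : iterm) (G : iformula) (eps : R)
    (D : seq (R * (size ix).-tuple nat)) :
  iexpr_wf (Aggregate ix t1 t2 G) -> List.In (p, Aggregate ix t1 t2 G) (Infer sp) ->
  0 <= eps -> all (fun lj => 0 < lj.1) D -> \sum_(lj <- D) lj.1 = 1 ->
  let at_ (lj : R * (size ix).-tuple nat) := inst_var ix lj.2 in
  let u1 := weighted_sum [seq (lj.1, trename (at_ lj) t1) | lj <- D] in
  let u2 := weighted_sum [seq (lj.1, trename (at_ lj) t2) | lj <- D] in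
  prob_le (fun iy : nat * NoiseVar S => (1 <= iy.1 <= n)%N)
    (fun iy => dist_law cI (state_val (s iy.1)) (Noise sp iy.2))
    (fun eta => ~ psat I (state_val (s n)) (Bounds sp (pupd (b n) p
       (eval_sbi impl cI (known eta)
         (SWhen (SAdd (STerm u1) (SCdf (noise_dists (Noise sp) u2) u2 (TLit eps)))
                (bigand [seq rename (at_ lj) G | lj <- D]))))))
    eps.
Proof.
move=> /and4P[_ qG /allP t1noise /allP t2obs] pe eps0 /allP D0 D1 at_ u1 u2.
set ds := noise_dists (Noise sp) u2.
have atP lj y : at_ lj (Plain y) = Plain y by [].
have atI (lj : R * (size ix).-tuple nat) :
    exists tau, forall y i, at_ lj (Idx y i) = Idx y (tau i).
  exists (fun i => if i is Sym k then
    (if k \in ix then Num (nth 0%N lj.2 (seq.index k ix)) else i) else i).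
  by move=> y [k|k] //=; case: ifP.
have at_base lj x : ivar_base (at_ lj x) = ivar_base x.
  by case: x => [y|y i] //; have [tau ->] := atI lj.
have u2obs : {in tvars u2, forall x, ~~ is_obs (ivar_base x)}.
  apply: tvars_weighted_sum_sub => lj x; rewrite tvars_rename => /mapP[x' xt ->].
  by rewrite at_base t2obs.
pose defined eta := cdf_defined cI (known eta) ds u2 (TLit eps).
(* [eta'] may differ from [eta] at the noise variables that [known] does not use. *)
have violation eta : ~ psat I (state_val (s n)) (Bounds sp (pupd (b n) p
       (eval_sbi impl cI (known eta)
         (SWhen (SAdd (STerm u1) (SCdf ds u2 (TLit eps)))
                (bigand [seq rename (at_ lj) G | lj <- D]))))) ->
    exists q, [/\ defined eta, impl cI (known eta) ds u2 (TLit eps) = Some q &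
      forall eta', known eta' = known eta -> q < eval I (actual eta') u2].
  move=> viol; apply: contrapT => nq; apply: viol; apply: psat_Bounds => r /=.
  case: ifP => // /andP[GD /asboolP /sat_bigand sG].
  case u1r: (peval _ _ u1) => [x1|] //; case: ifP => // defd.
  case bq: (impl _ _ _ _ _) => [q|] // [<-].
  (* Failing the claim, some [eta'] with the same knowledge keeps the noise sum at most [q]; the
     bound is then checked with [eta'] as the actual noise. *)
  have [eta' ke' u2q] : exists2 eta', known eta' = known eta &
      eval I (actual eta') u2 <= q.
    apply: contrapT => H; apply: nq; exists q; split=> // eta' ke'.
    by rewrite ltNge; apply/negP => ?; apply: H; exists eta'.
  have u1x : eval I (actual eta') u1 = x1.
    by have [] := @peval_known eta' id u1 x1; rewrite ?trename_id ?ke'.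
  have u1D : tdefined cI (known eta') u1 by move: u1r; rewrite ke' /peval; case: ifP.
  have ok lj : lj \in D -> bound_ok p (eval I (actual eta' \o at_ lj) (TAdd t1 t2)).
    move=> ljD; have [tau tauE] := atI lj.
    have [sGj Gk] : sat I G (actual eta' \o at_ lj) /\
        {in FV G, forall x, isSome (known eta' (at_ lj x))}.
      have ljIn : List.In (rename (at_ lj) G) [seq rename (at_ lj) G | lj <- D].
        apply/List_In_map; exists lj => //.
        by elim: (D) ljD => //= a l IH; rewrite inE => /orP[/eqP ->|/IH]; [left|right].
      apply: pholds_known => //; rewrite ke'; apply/andP; split.
        exact: (qf_over_bigand GD).
      by apply/asboolP; exact: sG.
    apply: (bound_of_obligation (atP lj) tauE (obligation_in pe _)) => // x.
    (* Definedness of the two sums makes the variables of [t1] known and those of [t2] known or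
       noise. *)
    rewrite !mem_cat => /or3P[xt|xt|/Gk ->] //.
    - apply/orP; left; apply: (term_overP u1D).
      apply: (@tvars_weighted_sum _ _ _ D fst (fun lj => trename (at_ lj) t1) _ ljD).
      by rewrite tvars_rename map_f.
    - have [_ /andP[u2D _]] := andP defd.
      have xu2 : at_ lj x \in tvars u2.
        apply: (@tvars_weighted_sum _ _ _ D fst (fun lj => trename (at_ lj) t2) _ ljD).
        by rewrite tvars_rename map_f.
      have := term_overP u2D xu2; rewrite /cdf_val; case: ifP => [|_].
        by move=> /noise_distsP[y [l [xE _]]]; rewrite -(at_base lj) xE orbT.
      by rewrite ke' => ->.
  (* Some instance lies at or below the weighted mean, which splits into the values of [u1] and
     [u2]; upward closure leads to [x1 + q]. *)
  have [lj ljD mean] := weighted_mean_ge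
    (fun lj => eval I (actual eta' \o at_ lj) (TAdd t1 t2)) D0 D1.
  apply: bound_ok_le (ok lj ljD); apply: le_trans mean _.
  under eq_bigr do rewrite /= mulrDr.
  rewrite big_split /= -u1x; apply: lerD; last apply: le_trans u2q.
    by rewrite eval_weighted_sum big_map; under [leRHS]eq_bigr do rewrite /= eval_rename.
  by rewrite eval_weighted_sum big_map; under [leRHS]eq_bigr do rewrite /= eval_rename.
(* If the operator is undefined for every outcome, no violation occurs; otherwise [eta0] supplies a
   reference valuation. *)
have [[eta0 def0]|nodef] := pselect (exists eta, defined eta); last first.
  apply: prob_le_impossible => // eta /violation[q [defd _ _]].
  by apply: nodef; exists eta.
pose v0 := known eta0.
pose Y (zeta : ivar S -> R) :=
  eval (total_interp cI) (total_val (cdf_val v0 ds zeta)) u2.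
have same eta x : x \in tvars u2 -> known eta x = v0 x.
  by move=> /u2obs; exact: known_noise.
have lawE eta : {in unzip1 ds, cdf_law cI (known eta) ds =1 cdf_law cI v0 ds}.
  by move=> x xds; have [y [l [xE _]]] := noise_distsP xds;
    rewrite xE in xds *; rewrite !cdf_law_known.
have [/allP lawS /andP[u2D _]] := andP def0.
have YE zeta : Y zeta = eval I (actual (fun ky => zeta (Idx (No ky.2) (Num ky.1)))) u2.
  rewrite /Y (eval_over total_const_interp _ u2D
    (s' := total_val (cdf_val v0 ds zeta))) //.
  apply: eval_coincidence => x xu2; have := term_overP u2D xu2.
  rewrite /total_val /cdf_val -/v0; case: ifP => [/noise_distsP[y [l [-> _]]] //|_].
  case v0x: (v0 x) => [r|] // _; apply/esym/known_actual.
  by rewrite same.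
(* The bound computed by [impl] varies with the observations, hence with the noise. *)
pose B : set R := [set q | prob_le [in unzip1 ds] (cdf_law cI v0 ds)
  (fun zeta => q < Y zeta) eps].
pose E1 (zeta : ivar S -> R) := exists2 q, B q & q < Y zeta.
have E1le : prob_le [in unzip1 ds] (cdf_law cI v0 ds) E1 eps.
  apply: prob_le_exists => // d T X mX.
  apply: (measurable_eval (v := fun x w => total_val (cdf_val v0 ds (X^~ w)) x) _ _ u2D).
    by case=> // k _; exists (c k).
  move=> x _; rewrite /total_val /cdf_val; case: (x \in unzip1 ds) => /=.
    exact: mX.
  exact: measurable_cst.
(* An action may name steps outside 1..n: their noise occurs in [u2] but not in
   the given family, and [E2] no longer depends on it. *)
pose ks := [seq x <- unzip1 ds |
  if x is Idx _ (Num l) then ~~ (1 <= l <= n)%N else false].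
pose E2 (zeta : ivar S -> R) :=
  forall zeta', (forall x, x \notin ks -> zeta' x = zeta x) -> E1 zeta'.
have E2le : prob_le [pred x in unzip1 ds | x \notin ks] (cdf_law cI v0 ds) E2 eps.
  apply: (prob_le_drop (ks := ks)).
  - by apply/allP => x; rewrite mem_filter => /andP[_ /lawS].
  - move=> k zeta r kks E2z zeta' zz'; apply: E2z => x xks.
    by rewrite zz'// /upd; case: eqP xks kks => // -> /negP.
  - apply: prob_le_mono E1le => //.
      by move=> x xds; rewrite !inE; case: (x \in ks) => //=; rewrite andbT.
    by move=> zeta; apply.
(* Once [ks] is removed, the listed noise variables correspond to pairs of a step in 1..n and a
   noise variable. *)
pose g (ky : nat * NoiseVar S) : ivar S := Idx (No ky.2) (Num ky.1).
pose k (x : ivar S) : option (nat * NoiseVar S) :=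
  if x is Idx (No y) (Num l) then Some (l, y) else None.
apply: (prob_le_reindex (k := k) (g := g) _ _ E2le).
  move=> x /andP[xds xks]; have [y [l [xE _]]] := noise_distsP xds.
  rewrite xE in xds xks *; exists (l, y); split=> //.
    by move: xks; rewrite mem_filter xds andbT negbK.
  rewrite /v0 cdf_law_known// ifT//.
  by move: xks; rewrite mem_filter xds andbT negbK.
move=> eta /violation[q [defd bq ql]] zeta' zz'.
(* Changes inside [ks] preserve what is known, so [ql] covers [zeta']. That [q] lies in [B] is
   correctness of [impl] at [known eta], moved to [v0], which gives the same laws and the same noise
   sum. *)
exists q; last first.
  rewrite YE; apply: ql; apply: eq_known => l y ln.
  by rewrite /= zz'// mem_filter ln.
have := impl_correct defd bq; apply: prob_le_mono => //.
move=> zeta; rewrite /Y; congr (_ < _); apply: eval_coincidence => x xu2.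
by rewrite /total_val /cdf_val; case: ifP => // _; rewrite same.
Qed.

End Soundness.

Theorem theorem5p1 (R : realType) (S : signature) (sp : shield_spec R S)
    (impl : cdf_impl R (@sym_arity S) (ivar S)) :
  cdf_impl_correct impl ->
  valid (obligation sp) ->
  forall (a : actions (Infer sp)) (t : Param S * sbi R (@sym_arity S) (ivar S) * R),
    List.In t (instantiate (Noise sp) a) -> sound sp impl t.
Proof.
move=> impl_correct obl a t /instantiate_in[p [e [a1 [pe ta]]]].
have wf := List_In_all (Infer_wf sp) pe.
case: e a1 pe ta wf => [t0 G|ix t0 G|ix t1 t2 G] a1 pe.
- case=> // <- /= qG c u n s z b n0 hyp.
  apply: prob_le_impossible => // eta; apply.
  have := sound_deterministic impl z n0 hyp eta (sigma := id) (tau := id)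
    (fun=> erefl) (fun _ _ => erefl) qG (obligation_in obl c u pe).
  by rewrite trename_id rename_id_qf.
- move=> /List_In_map[j _ <-] /andP[_ qG] c u n s z b n0 hyp.
  apply: prob_le_impossible => // eta; apply.
  apply: (sound_deterministic impl z n0 hyp eta (tau := fun i => if i is Sym k then
    (if k \in ix then Num (nth 0%N j (seq.index k ix)) else i) else i)) => //.
    by move=> y [k|k] //=; case: ifP.
  exact: (obligation_in obl c u pe).
- case: a1 => -[eps D] /= [/andP[eps0 _] D0 D1] [<-|//] wf c u n s z b n0 hyp.
  exact: (sound_aggregate impl_correct obl z n0 hyp wf pe eps0 D0 D1).
Qed.
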